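(* Fix a dimension $d\ge2$. There is a constant $C_d$ depending only on $d$ such that the following holds. Let $n,n_0,p$ be positive integers with $p\le n_0\le 2p$, and put $N_0=n_0^d$ and $N=n^d$. Let $I=[n]^d$ be the index set of the uniform tensor grid on $[0,1]^d$ with $n$ points in each direction, let $T_I$ be the tensor node cluster tree constructed by recursive $2^d$ uniform partition, each of whose leaf nodes contains at most $N_0$ points, and let $T_{I\times I}$ be the corresponding tensor node block cluster tree under either the weak admissibility condition or the strong admissibility condition with $\eta=\sqrt d$. Then the HTLR construction algorithm, applied with functions $a(\boldsymbol{x})$, $k(\boldsymbol{x},\boldsymbol{y})$ and target rank $p$, constructs the rank-$p$ HTLR matrix on $T_{I\times I}$ in at most $C_d\,p^{d+1}N$ operations, i.e. the total construction complexity is $O(p^{d+1}N)$.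
   Context: Notation: $[n]=\{1,\dots,n\}$, $h=1/n$. Grid: the grid point with multi-index $\boldsymbol{i}=(i_1,\dots,i_d)\in[n]^d$ is $\boldsymbol{x}_{\boldsymbol{i}}=((i_1-\tfrac12)h,\dots,(i_d-\tfrac12)h)$, with computational domain $\Omega_{\boldsymbol{i}}=\prod_\ell[(i_\ell-1)h,i_\ell h]$. For $\tau\subset I$, $\Omega_\tau=\bigcup_{\boldsymbol{i}\in\tau}\Omega_{\boldsymbol{i}}$. Matrix to be represented: $\boldsymbol{A}_{\boldsymbol{i},\boldsymbol{j}}=a(\boldsymbol{x}_{\boldsymbol{i}})\delta_{\boldsymbol{i},\boldsymbol{j}}+K_{\boldsymbol{i},\boldsymbol{j}}h^d$, where $\delta$ is the Kronecker delta, $K_{\boldsymbol{i},\boldsymbol{j}}=k(\boldsymbol{x}_{\boldsymbol{i}},\boldsymbol{x}_{\boldsymbol{j}})$ for $\boldsymbol{j}\ne\boldsymbol{i}$ and $K_{\boldsymbol{i},\boldsymbol{i}}=h^{-d}\int_{\Omega_{\boldsymbol{i}}}k(\boldsymbol{x}_{\boldsymbol{i}},\boldsymbol{y})\,d\boldsymbol{y}$ (computed numerically). Cluster tree: a tree $T_I$ whose nodes are nonempty subsets of $I$, with root $I$, such that each node either has no children (a leaf) or is the disjoint union of its children. It is a tensor node cluster tree if every node has the form $\tau=\tau_1\times\dots\times\tau_d$, with $\tau_\ell$ an index set for the $\ell$-th dimension. Recursive $2^d$ uniform partition: a node $\tau$ with $|\tau|\le N_0$ is a leaf and is not partitioned further;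 a node with $|\tau|>N_0$ is split into (up to) $2^d$ children by splitting each index interval $\tau_\ell$ into two consecutive intervals of sizes as equal as possible (empty children are discarded). Weak admissibility: two nodes $\tau,\sigma$ are admissible if $\Omega_\tau\cap\Omega_\sigma$ has measure zero. Strong admissibility with parameter $\eta>0$: $\tau,\sigma$ are admissible if $\max\{\operatorname{diam}(\Omega_\tau),\operatorname{diam}(\Omega_\sigma)\}\le\eta\operatorname{dist}(\Omega_\tau,\Omega_\sigma)$ (Euclidean diameter and distance). Block cluster tree $T_{I\times I}$: built from the root $(I,I)$ as follows. If $\tau,\sigma$ are admissible, $(\tau,\sigma)$ is an admissible leaf; otherwise, if $\tau$ or $\sigma$ is a leaf of $T_I$, $(\tau,\sigma)$ is an inadmissible leaf; otherwise $(\tau,\sigma)$ is a non-leaf node with children all $(\tau',\sigma')\in\operatorname{children}(\tau)\times\operatorname{children}(\sigma)$. It is called a tensor node block cluster tree when $T_I$ is a tensor node cluster tree. HTLR (hierarchical Tucker low-rank) matrix of rank $p$ on $T_{I\times I}$: a matrix in $\mathbb{R}^{I\times I}$ whose blocks at admissible leaves $(\tau,\sigma)$ are, viewed as $2d$-order tensors, in Tucker form $\boldsymbol{\mathcal{G}}\times_1\boldsymbol{U}_1\times_2\cdots\times_d\boldsymbol{U}_d\times_{d+1}\boldsymbol{V}_1\times_{d+2}\cdots\times_{2d}\boldsymbol{V}_d$ with rank at most $p$ in each mode ($\boldsymbol{U}_\ell$ has $|\tau_\ell|$ rows, $\boldsymbol{V}_\ell$ has $|\sigma_\ell|$ rows,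 each at most $p$ columns; $\times_\ell$ is the mode-$\ell$ product), whose blocks at inadmissible leaves are dense, and whose blocks at non-leaf nodes are assembled from the children. Chebyshev interpolation: on $[a,b]$ the $p$ Chebyshev points are $\xi_t=\frac{b-a}{2}\cos\left(\frac{(2t-1)\pi}{2p}\right)+\frac{b+a}{2}$, $1\le t\le p$, with Lagrange functions $L_{[a,b];t}(x)=\prod_{j\ne t}\frac{x-\xi_j}{\xi_t-\xi_j}$; on a box the tensor Chebyshev points $\boldsymbol{\xi}_{\boldsymbol{t}}$, $\boldsymbol{t}\in[p]^d$, are formed coordinatewise. HTLR construction algorithm (recursive, starting from $(I,I)$). (i) Admissible leaf $(\tau,\sigma)$, with $\Omega_\tau=\prod_\ell[a_\ell,b_\ell]$, $\Omega_\sigma=\prod_\ell[c_\ell,d_\ell]$, tensor Chebyshev points $\boldsymbol{\xi}_{\boldsymbol{t}}$ of $\Omega_\tau$ and $\boldsymbol{\eta}_{\boldsymbol{s}}$ of $\Omega_\sigma$: form $\boldsymbol{U}_\ell(i,\mu)=L_{[a_\ell,b_\ell];\mu}(x_{\ell;i})$ and $\boldsymbol{V}_\ell(j,\nu)=L_{[c_\ell,d_\ell];\nu}(y_{\ell;j})$, where $x_{\ell;i}$, $y_{\ell;j}$ are the $\ell$-th coordinates of the grid points of $\tau$, $\sigma$, and the core $\boldsymbol{\mathcal{G}}(\boldsymbol{t},\boldsymbol{s})=k(\boldsymbol{\xi}_{\boldsymbol{t}},\boldsymbol{\eta}_{\boldsymbol{s}})$; compute QR factorizations $\boldsymbol{U}_\ell=\boldsymbol{W}_\ell\boldsymbol{R}_\ell$,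 $\boldsymbol{V}_\ell=\boldsymbol{Q}_\ell\boldsymbol{T}_\ell$ for each $\ell$; replace $\boldsymbol{U}_\ell,\boldsymbol{V}_\ell$ by $\boldsymbol{W}_\ell,\boldsymbol{Q}_\ell$ and $\boldsymbol{\mathcal{G}}$ by $(h^d\boldsymbol{\mathcal{G}})\times_1\boldsymbol{R}_1\times_2\cdots\times_d\boldsymbol{R}_d\times_{d+1}\boldsymbol{T}_1\times_{d+2}\cdots\times_{2d}\boldsymbol{T}_d$ (mode by mode). (ii) Inadmissible leaf: form the dense block of $\boldsymbol{A}$ directly. (iii) Non-leaf node: recurse on each child. Complexity is the number of operations, where arithmetic operations, evaluations of $a$ and $k$, and the numerical evaluation of each diagonal integral count as $O(1)$ each, and QR factorizations and contractions are carried out by the standard dense algorithms. *)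

(* Defs.v *)
From HB Require Import structures.
From mathcomp Require Import all_boot all_order all_algebra.
From mathcomp Require Import all_classical all_reals all_analysis.

Set Implicit Arguments.
Unset Strict Implicit.
Unset Printing Implicit Defensive.
Import Order.TTheory GRing.Theory Num.Theory.
Local Open Scope classical_set_scope.
Local Open Scope ring_scope.

(* d-dimensional Lebesgue measure on tuples, by recursion on d: the product
   of the one-dimensional measure with the measure in dimension d - 1, carried
   over from R * R^(d-1) to R^d. *)
Section LebesgueTuple.
Context (R : realType).
Notation RR := (measurableTypeR R).

Definition tuple_cons n (x : RR * n.-tuple RR) : n.+1.-tuple RR :=
  [tuple of x.1 :: x.2].

Definition tuple_uncons n (x : n.+1.-tuple RR) : RR * n.-tuple RR :=
  (thead x, [tuple of behead x]).

Lemma measurable_tuple_cons n : measurable_fun setT (@tuple_cons n).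
Proof. exact: measurable_cons. Qed.

Lemma measurable_tuple_uncons n : measurable_fun setT (@tuple_uncons n).
Proof.
apply: measurable_fun_pair => /=; first exact: measurable_tnth.
exact: measurable_behead.
Qed.

Lemma tuple_consK n : cancel (@tuple_cons n) (@tuple_uncons n).
Proof. by case=> x y; congr pair; apply/val_inj. Qed.

Section Step.
Context n (mu : {sigma_finite_measure set (n.-tuple RR) -> \bar R}).

Definition lebesgue_step : set (n.+1.-tuple RR) -> \bar R :=
  pushforward (@lebesgue_measure R \x mu)%E (@tuple_cons n).

Let step_measure :
  exists m : {measure set (n.+1.-tuple RR) -> \bar R}, lebesgue_step = m.
Proof.
by unshelve eexists (pushforward (@lebesgue_measure R \x mu)%E (@tuple_cons n));
  [exact: measurable_tuple_cons|].
Qed.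

Let step0 : lebesgue_step set0 = 0%E.
Proof. by have [m ->] := step_measure; exact: measure0. Qed.

Let step_ge0 A : (0 <= lebesgue_step A)%E.
Proof. by have [m ->] := step_measure; exact: measure_ge0. Qed.

Let step_sigma_additive : semi_sigma_additive lebesgue_step.
Proof. by have [m ->] := step_measure; exact: measure_semi_sigma_additive. Qed.

HB.instance Definition _ := isMeasure.Build _ _ _ lebesgue_step
  step0 step_ge0 step_sigma_additive.

Let step_sigma_finite : sigma_finite setT lebesgue_step.
Proof.
have /sigma_finiteP[F [TF ndF Foo]] := sigma_finiteT (@lebesgue_measure R).
have /sigma_finiteP[G [TG ndG Goo]] := sigma_finiteT mu.
exists (fun i => @tuple_uncons n @^-1` (F i `*` G i)).
  rewrite -preimage_bigcup (_ : \bigcup_i _ = setT)//.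
  rewrite -setXTT TF TG; apply/seteqP; split=> -[x y] /=.
    by move=> [i _ []]; split; exists i.
  move=> [[i _ Fx] [j _ Gy]]; exists (maxn i j) => //; split.
    by move: x Fx; apply/subsetPset/ndF/leq_maxl.
  by move: y Gy; apply/subsetPset/ndG/leq_maxr.
move=> i; have [mFi Ffin] := Foo i; have [mGi Gfin] := Goo i; split.
  rewrite -[X in measurable X]setTI.
  by apply: measurable_tuple_uncons => //; exact: measurableX.
rewrite /lebesgue_step /pushforward (_ : _ @^-1` _ = F i `*` G i).
  by rewrite product_measure1E// lte_mul_pinfty// ge0_fin_numE.
by apply/funext => x; rewrite /preimage /mkset tuple_consK.
Qed.

HB.instance Definition _ := Measure_isSigmaFinite.Build _ _ _ lebesgue_step
  step_sigma_finite.

End Step.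

Fixpoint lebesgue_tuple n : {sigma_finite_measure set (n.-tuple RR) -> \bar R} :=
  match n with
  | 0 => \d_ ([tuple] : 0.-tuple RR)
  | n'.+1 => lebesgue_step (lebesgue_tuple n')
  end.

End LebesgueTuple.

(* Programs that count their operations: a result, and the number of
   operations spent on it. *)
Section Counting.

Definition counted (A : Type) : Type := (A * nat)%type.
Definition result A (c : counted A) : A := c.1.
Definition ops A (c : counted A) : nat := c.2.
Definition ret A (x : A) : counted A := (x, 0%N).
Definition bind A B (c : counted A) (f : A -> counted B) : counted B :=
  ((f c.1).1, (c.2 + (f c.1).2)%N).
Definition op A (x : A) : counted A := (x, 1%N).

Definition tab (I : finType) A (f : I -> counted A) : counted (I -> A) :=
  (fun i => (f i).1, (\sum_i (f i).2)%N).
Definition tab_dep (I : finType) (A : I -> Type) (f : forall i, counted (A i)) :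
    counted (forall i, A i) :=
  (fun i => (f i).1, (\sum_i (f i).2)%N).

Fixpoint seqc A (cs : seq (counted A)) : counted (seq A) :=
  if cs is c :: cs' then bind c (fun x => bind (seqc cs') (fun s => ret (x :: s)))
  else ret [::].

Fixpoint foldc A B (f : B -> A -> counted B) (y : B) (s : seq A) : counted B :=
  if s is x :: s' then bind (f y x) (fun y' => foldc f y' s') else ret y.

End Counting.

Notation "x <-- c ;; e" := (bind c (fun x => e))
  (at level 100, c at next level, right associativity).

Section Arithmetic.
Context (R : realType).

Definition addc (x y : R) := op (x + y).
Definition subc (x y : R) := op (x - y).
Definition mulc (x y : R) := op (x * y).
Definition divc (x y : R) := op (x / y).
Definition sqrtc (x : R) := op (Num.sqrt x).
Definition cosc (x : R) := op (cos x).
Definition is0c (x : R) := op (x == 0).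

Definition sumc (I : finType) (f : I -> counted R) : counted R :=
  foldc (fun s i => x <-- f i ;; addc s x) 0 (enum I).
Definition prodc (I : finType) (P : pred I) (f : I -> counted R) : counted R :=
  foldc (fun s i => x <-- f i ;; mulc s x) 1 (enum P).

Definition tab_mx m n (f : 'I_m -> 'I_n -> counted R) : counted 'M[R]_(m, n) :=
  g <-- tab (fun ij : 'I_m * 'I_n => f ij.1 ij.2) ;;
  ret (\matrix_(i, j) g (i, j)).

Definition dotc m (u v : 'cV[R]_m) : counted R :=
  sumc (fun i => mulc (u i 0) (v i 0)).

(* QR factorization by modified Gram-Schmidt.  The state is the list of the
   orthonormal vectors found so far and the list of the columns of the
   triangular factor.  A column which lies in the span of the previous ones
   (this is forced when m < p) contributes no new vector. *)
Fixpoint orthogonalize m (v : 'cV[R]_m) (qs : seq 'cV[R]_m) :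
    counted ('cV[R]_m * seq R) :=
  if qs is q :: qs' then
    r <-- dotc q v ;;
    v' <-- tab_mx (fun i (_ : 'I_1) => x <-- mulc r (q i 0) ;; subc (v i 0) x) ;;
    w <-- orthogonalize v' qs' ;;
    ret (w.1, r :: w.2)
  else ret (v, [::]).

Definition qr_step m (st : seq 'cV[R]_m * seq (seq R)) (v : 'cV[R]_m) :
    counted (seq 'cV[R]_m * seq (seq R)) :=
  w <-- orthogonalize v st.1 ;;
  nn <-- dotc w.1 w.1 ;;
  nrm <-- sqrtc nn ;;
  z <-- is0c nrm ;;
  if z then ret (st.1, rcons st.2 w.2)
  else
    q <-- tab_mx (fun i (_ : 'I_1) => divc (w.1 i 0) nrm) ;;
    ret (rcons st.1 q, rcons st.2 (rcons w.2 nrm)).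

(* The factors are stored with p columns, resp. p rows: if the rank r is
   smaller than p, the last p - r columns of the orthonormal factor and the
   last p - r rows of the triangular factor are zero. *)
Definition qr m p (B : 'M[R]_(m, p)) : counted ('M[R]_(m, p) * 'M[R]_p) :=
  st <-- foldc (@qr_step m) ([::], [::]) [seq col j B | j <- enum 'I_p] ;;
  ret (\matrix_(i < m, j < p) (nth 0 st.1 j) i 0,
       \matrix_(i < p, j < p) nth 0 (nth [::] st.2 j) i).

Definition chebyshev p (a b : R) (t : 'I_p) : R :=
  (b - a) / 2 * cos ((2 * t + 1)%:R * pi / (2 * p)%:R) + (b + a) / 2.

Definition lagrange p (a b : R) (t : 'I_p) (x : R) : R :=
  \prod_(j < p | j != t)
    ((x - chebyshev a b j) / (chebyshev a b t - chebyshev a b j)).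

Definition chebyshevc p (a b : R) (t : 'I_p) : counted R :=
  w <-- subc b a ;;
  w2 <-- divc w 2 ;;
  u <-- mulc (2 * t + 1)%:R pi ;;
  th <-- divc u (2 * p)%:R ;;
  c <-- cosc th ;;
  y <-- mulc w2 c ;;
  s <-- addc b a ;;
  s2 <-- divc s 2 ;;
  addc y s2.

Definition lagrangec p (xi : 'I_p -> R) (t : 'I_p) (x : R) : counted R :=
  prodc (fun j => j != t)
    (fun j => u <-- subc x (xi j) ;; v <-- subc (xi t) (xi j) ;; divc u v).

End Arithmetic.

Section ClusterTrees.
Context (d n : nat).

(* Multi-indices and positions are counted from 0. *)
Definition grid := {ffun 'I_d -> 'I_n}.

(* tau = tau_1 x ... x tau_d *)
Definition node := {ffun 'I_d -> {set 'I_n}}.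

Definition points (tau : node) : {set grid} :=
  [set i : grid | [forall l, i l \in tau l]].

(* Since 'I_n is enumerated increasingly, these are two consecutive pieces; for
   an odd size the first piece gets the extra index. *)
Definition half (A : {set 'I_n}) (b : bool) : {set 'I_n} :=
  let k := uphalf #|A| in
  if b then [set x in drop k (enum A)] else [set x in take k (enum A)].

Definition parts (tau : node) : seq node :=
  [seq c <- [seq [ffun l => half (tau l) (b l)] | b : {ffun 'I_d -> bool} <-
               enum {ffun 'I_d -> bool}] | points c != finset.set0].

Inductive ctree := CNode of node & seq ctree.

(* The fuel bounds the depth: for N0 > 0, each part of a node with more than N0
   points has fewer points than the node. *)
Fixpoint uniform_partition (fuel N0 : nat) (tau : node) : ctree :=
  CNode tau
    (if (#|points tau| <= N0)%N then [::]
     else if fuel is f.+1 then [seq uniform_partition f N0 c | c <- parts tau]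
     else [::]).

Definition cluster_tree (N0 : nat) : ctree :=
  uniform_partition #|{: grid}| N0 [ffun=> finset.setT].

Inductive btree :=
| BAdm of node & node
| BDense of node & node
| BNode of node & node & seq btree.

Fixpoint block_tree (adm : node -> node -> Prop) (T S : ctree) : btree :=
  let: CNode tau ts := T in
  let: CNode sigma ss := S in
  if `[< adm tau sigma >] then BAdm tau sigma
  else if nilp ts || nilp ss then BDense tau sigma
  else BNode tau sigma (flatten [seq [seq block_tree adm t s | s <- ss] | t <- ts]).

Definition block_cluster_tree (adm : node -> node -> Prop) (N0 : nat) : btree :=
  block_tree adm (cluster_tree N0) (cluster_tree N0).

Fixpoint all_leaves (P Q : node -> node -> Prop) (T : btree) : Prop :=
  match T with
  | BAdm tau sigma => P tau sigma
  | BDense tau sigma => Q tau sigma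
  | BNode _ _ ts => foldr (fun t A => all_leaves P Q t /\ A) True ts
  end.

Definition local (tau : node) := {dffun forall l : 'I_d, 'I_#|tau l|}.

Definition global (tau : node) (i : local tau) : grid :=
  [ffun l => enum_val (i l)].

End ClusterTrees.

Section Geometry.
Context (R : realType) (d n : nat).
Local Notation point := (d.-tuple (measurableTypeR R)).
Local Notation node := (node d n).
Local Notation grid := (grid d n).

Definition coord (x : point) (l : 'I_d) : R := tnth x l.

Definition meshsize : R := n%:R^-1.
Local Notation h := meshsize.

Definition gridpoint (i : grid) : point := [tuple ((i l)%:R + 2^-1) * h | l < d].

Definition cell (i : grid) : set point :=
  [set x | forall l, (i l)%:R * h <= coord x l <= (i l).+1%:R * h].

Definition Omega (tau : node) : set point :=
  [set x | exists2 i, i \in points tau & cell i x].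

Definition euclid (x y : point) : R :=
  Num.sqrt (\sum_(l < d) (coord x l - coord y l) ^+ 2).

Definition diam (A : set point) : R :=
  sup [set r | exists x y, [/\ A x, A y & r = euclid x y]].

Definition dist (A B : set point) : R :=
  inf [set r | exists x y, [/\ A x, B y & r = euclid x y]].

Definition weak_admissible (tau sigma : node) : Prop :=
  lebesgue_tuple R d (Omega tau `&` Omega sigma) = 0%E.

Definition strong_admissible (eta : R) (tau sigma : node) : Prop :=
  Num.max (diam (Omega tau)) (diam (Omega sigma)) <=
  eta * dist (Omega tau) (Omega sigma).

End Geometry.

(* HTLR representations: Tucker data at the admissible leaves, entries at the
   inadmissible ones.  The 2d modes are indexed by 'I_d + 'I_d, the row modes
   being the left summand. *)
Section HTLR.
Context (R : realType) (d n : nat).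
Local Notation node := (node d n).
Local Notation grid := (grid d n).

Definition mode := ('I_d + 'I_d)%type.
Definition coreidx (r : mode -> nat) := {dffun forall m : mode, 'I_(r m)}.

Record tucker (tau sigma : node) := Tucker {
  rank : mode -> nat;
  core : coreidx rank -> R;
  rowfactor : forall l : 'I_d, 'M[R]_(#|tau l|, rank (inl l));
  colfactor : forall l : 'I_d, 'M[R]_(#|sigma l|, rank (inr l)) }.

Definition tucker_entry tau sigma (X : tucker tau sigma)
    (i : local tau) (j : local sigma) : R :=
  \sum_(t : coreidx (rank X)) core t *
    (\prod_(l < d) rowfactor X l (i l) (t (inl l))) *
    (\prod_(l < d) colfactor X l (j l) (t (inr l))).

Definition dense (tau sigma : node) := local tau -> local sigma -> R.

Inductive htlr :=
| HAdm (tau sigma : node) of tucker tau sigma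
| HDense (tau sigma : node) of dense tau sigma
| HNode (tau sigma : node) of seq htlr.

Fixpoint structure (H : htlr) : btree d n :=
  match H with
  | @HAdm tau sigma _ => BAdm tau sigma
  | @HDense tau sigma _ => BDense tau sigma
  | HNode tau sigma hs => BNode tau sigma [seq structure h | h <- hs]
  end.

Fixpoint all_data (P : forall tau sigma, tucker tau sigma -> Prop)
    (Q : forall tau sigma, dense tau sigma -> Prop) (H : htlr) : Prop :=
  match H with
  | HAdm _ _ X => P _ _ X
  | HDense _ _ D => Q _ _ D
  | HNode _ _ hs => foldr (fun h A => all_data P Q h /\ A) True hs
  end.

(* M is the rank-p HTLR matrix on T represented by H. *)
Definition HTLR_matrix (p : nat) (T : btree d n) (H : htlr)
    (M : grid -> grid -> R) : Prop :=
  [/\ structure H = T,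
      all_data (fun _ _ X => forall m, (rank X m <= p)%N) (fun _ _ _ => True) H &
      all_data
        (fun tau sigma X => forall i j,
           M (global i) (global j) = tucker_entry X i j)
        (fun tau sigma D => forall i j, M (global i) (global j) = D i j) H].

End HTLR.

Section Construction.
Context (R : realType) (d n : nat).
Local Notation point := (d.-tuple (measurableTypeR R)).
Local Notation node := (node d n).
Local Notation grid := (grid d n).
Local Notation mode := (mode d).
Local Notation h := (meshsize R n).
Context (a : point -> R) (k : point -> point -> R) (p : nat).

Definition diag_integral (i : grid) : R :=
  \int[lebesgue_tuple R d]_(y in cell i) k (gridpoint R i) y.

Definition kernel_entry (i j : grid) : R :=
  if j == i then h ^- d * diag_integral i
  else k (gridpoint R i) (gridpoint R j).

Definition mxA (i j : grid) : R :=
  a (gridpoint R i) * (i == j)%:R + kernel_entry i j * h ^+ d.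

(* For an interval A of indices, the one-dimensional domain of A is
   [left_end A, right_end A]. *)
Definition left_end (A : {set 'I_n}) : R :=
  (\big[minn/n]_(x in A) (x : nat))%:R * h.
Definition right_end (A : {set 'I_n}) : R := (\max_(x in A) x.+1)%:R * h.

Definition cheb_point (tau : node) (t : {ffun 'I_d -> 'I_p}) : point :=
  [tuple chebyshev (left_end (tau l)) (right_end (tau l)) (t l) | l < d].

Definition node_lagrange (tau : node) (t : {ffun 'I_d -> 'I_p}) (i : grid) : R :=
  \prod_(l < d) lagrange (left_end (tau l)) (right_end (tau l)) (t l)
                  (coord (gridpoint R i) l).

Definition interp_entry (tau sigma : node) (i j : grid) : R :=
  h ^+ d * \sum_(t : {ffun 'I_d -> 'I_p}) \sum_(s : {ffun 'I_d -> 'I_p})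
    k (cheb_point tau t) (cheb_point sigma s) *
    node_lagrange tau t i * node_lagrange sigma s j.

(* The matrix that the algorithm is meant to produce: the Chebyshev
   interpolant of the kernel on admissible blocks, A on the others. *)
Definition interpolates (T : btree d n) (M : grid -> grid -> R) : Prop :=
  all_leaves
    (fun tau sigma => forall i j, i \in points tau -> j \in points sigma ->
       M i j = interp_entry tau sigma i j)
    (fun tau sigma => forall i j, i \in points tau -> j \in points sigma ->
       M i j = mxA i j) T.

Definition evala (x : point) := op (a x).
Definition evalk (x y : point) := op (k x y).
Definition eval_diag (i : grid) := op (diag_integral i).

Definition gridcoordc (x : 'I_n) : counted R := s <-- addc x%:R 2^-1 ;; mulc s h.

Definition gridpointc (i : grid) : counted point :=
  x <-- tab (fun l => gridcoordc (i l)) ;; ret [tuple x l | l < d].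

Definition cellvolumec : counted R := prodc predT (fun _ : 'I_d => ret h).

Definition entryc (i j : grid) : counted R :=
  hd <-- cellvolumec ;;
  x <-- gridpointc i ;;
  if j == i then
    ax <-- evala x ;;
    q <-- eval_diag i ;;
    kii <-- divc q hd ;;
    b <-- mulc kii hd ;;
    addc ax b
  else
    y <-- gridpointc j ;;
    kij <-- evalk x y ;;
    mulc kij hd.

Definition dense_leaf (tau sigma : node) : counted (htlr R d n) :=
  D <-- tab (fun i : local tau =>
          tab (fun j : local sigma => entryc (global i) (global j))) ;;
  ret (@HDense R d n tau sigma D).

(* One-dimensional Chebyshev points, and the matrix of the values of their
   Lagrange functions at the grid coordinates. *)
Definition interpc (A : {set 'I_n}) : counted (('I_p -> R) * 'M[R]_(#|A|, p)) :=
  al <-- mulc (\big[minn/n]_(x in A) (x : nat))%:R h ;;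
  bl <-- mulc (\max_(x in A) x.+1)%:R h ;;
  xi <-- tab (fun t : 'I_p => chebyshevc al bl t) ;;
  x <-- tab (fun i : 'I_#|A| => gridcoordc (enum_val i)) ;;
  U <-- tab_mx (fun i t => lagrangec xi t (x i)) ;;
  ret (xi, U).

Definition midx := coreidx (fun _ : mode => p).

Definition set_mode (t : midx) (m : mode) (j : 'I_p) : midx :=
  [ffun m' => if m' == m then j else t m'].

(* G x_m B *)
Definition mode_product (m : mode) (B : 'M[R]_p) (G : midx -> R) :
    counted (midx -> R) :=
  tab (fun t : midx => sumc (fun j : 'I_p => mulc (B (t m) j) (G (set_mode t m j)))).

Definition adm_leaf (tau sigma : node) : counted (htlr R d n) :=
  F <-- tab_dep (fun l => interpc (tau l)) ;;
  E <-- tab_dep (fun l => interpc (sigma l)) ;;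
  G <-- tab (fun t : midx =>
          evalk [tuple (F l).1 (t (inl l)) | l < d]
                [tuple (E l).1 (t (inr l)) | l < d]) ;;
  WR <-- tab_dep (fun l => qr (F l).2) ;;
  QT <-- tab_dep (fun l => qr (E l).2) ;;
  hd <-- cellvolumec ;;
  G0 <-- tab (fun t : midx => mulc hd (G t)) ;;
  G1 <-- foldc (fun G' (m : mode) =>
           mode_product m
             (match m with inl l => (WR l).2 | inr l => (QT l).2 end) G')
           G0 (enum {: mode}) ;;
  ret (HAdm (@Tucker R d n tau sigma (fun=> p) G1
               (fun l => (WR l).1) (fun l => (QT l).1))).

Fixpoint construct (T : btree d n) : counted (htlr R d n) :=
  match T with
  | BAdm tau sigma => adm_leaf tau sigma
  | BDense tau sigma => dense_leaf tau sigma
  | BNode tau sigma ts =>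
      hs <-- seqc [seq construct t | t <- ts] ;; ret (HNode tau sigma hs)
  end.

End Construction.

(* Main.v *)
Require Import Defs.
From mathcomp Require Import all_boot all_order all_algebra.
From mathcomp Require Import all_classical all_reals all_analysis.
From mathcomp Require Import zify ring lra.

Set Implicit Arguments.
Unset Strict Implicit.
Unset Printing Implicit Defensive.
Local Open Scope ring_scope.
Import Order.TTheory GRing.Theory Num.Theory.

(** The algorithm is correct because a QR factorization changes nothing in the
    product: if U = W R at every mode, then pushing the factors R into the core
    and keeping the factors W represents the same tensor as the core of kernel
    values with the factors U, which is the Chebyshev interpolant
    ([adm_leaf_tucker]).  The identity W R = U is the bookkeeping of the
    Gram-Schmidt process: a column is the sum of what is subtracted from it and
    of the remainder ([qr_mul]).  The leaf blocks glue to one matrix since the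
    parts of a node are disjoint ([interpolates_partition_block]).

    For the complexity, call level of a node the number of halvings which led
    to it, and let q be the integer part of n / 2^L.  A node of level L is a
    box with sides of q or q + 1 indices ([card_box]), so it is described by
    its position in {0, ..., 2^L - 1}^d.  If the positions of two boxes differ
    by at least 3 in some coordinate, then two whole intervals lie between them
    there, and the gap of 2q cells is at least the side q + 1 of the boxes,
    provided that q > 0: such a pair is admissible, weakly because the domains are disjoint, and
    strongly with eta = sqrt d because the diameters are at most sqrt d times
    the side ([far_weak_admissible], [far_strong_admissible]).  Hence a pair
    which is split has all its coordinates nearby, and so the number of pairs
    of level L in the block cluster tree is O(2^(dL)), with a constant that
    depends on d only ([near_pairs0], [ops_partition_block_le]).

    One leaf of level L costs O(p^(2d+1) + (q + 1) p^2) operations: the first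
    term is the core with its 2d mode products, the second the interpolation
    matrices and their QR factorizations; a dense leaf has sides of O(p)
    indices and costs O(p^(2d)) ([ops_adm_leaf_box], [ops_dense_leaf_box]).  A
    node is only split while n0 <= q, so the last level J satisfies
    n0 2^J <= 2n, hence p 2^J <= 2n.  The sums over the levels are geometric:
    p^(2d+1) 2^(dL) adds up to O(p^(2d+1) (n/p)^d) = O(p^(d+1) N), and
    (n / 2^L) p^2 2^(dL) adds up to O(n p^2 n^(d-1)), which is where d >= 2
    enters ([leaf_cost_sum_le]).

    This argument needs n0 < n.  Otherwise the root is a leaf of the cluster
    tree, and n can be much smaller than p, so that an admissible root would be
    too expensive.  But the pair (I, I) is never admissible
    ([root_not_weak_admissible], [root_not_strong_admissible]), so there is
    one dense block, of n^(2d) <= n0^d n^d entries. *)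

(** * Results and operation counts of counted programs *)

Section CountedPrograms.

Lemma ops_bind A B (c : counted A) (f : A -> counted B) :
  ops (bind c f) = (ops c + ops (f (result c)))%N.
Proof. by []. Qed.

Lemma ops_ret A (x : A) : ops (ret x) = 0%N.
Proof. by []. Qed.

Lemma ops_op A (x : A) : ops (op x) = 1%N.
Proof. by []. Qed.

Lemma result_foldc A B (f : B -> A -> counted B) y s :
  result (foldc f y s) = foldl (fun y' x => result (f y' x)) y s.
Proof. by elim: s y => //= x s IHs y; rewrite /result /= -IHs. Qed.

Lemma ops_foldc_le A B (f : B -> A -> counted B) y s K :
  (forall y' x, ops (f y' x) <= K)%N -> (ops (foldc f y s) <= size s * K)%N.
Proof.
move=> fK; elim: s y => //= x s IHs y.
by rewrite /ops /= mulSn leq_add//; [exact: fK|exact: IHs].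
Qed.

Lemma result_seqc A (cs : seq (counted A)) :
  result (seqc cs) = [seq result c | c <- cs].
Proof. by elim: cs => //= c cs IHcs; rewrite /result /= -IHcs. Qed.

Lemma ops_seqc A (cs : seq (counted A)) :
  ops (seqc cs) = (\sum_(c <- cs) ops c)%N.
Proof.
elim: cs => [|c cs IHcs]; first by rewrite big_nil.
by rewrite big_cons -IHcs /ops /= addn0.
Qed.

Lemma ops_tab_le (I : finType) A (f : I -> counted A) K :
  (forall i, ops (f i) <= K)%N -> (ops (tab f) <= #|I| * K)%N.
Proof. by move=> fK; rewrite -sum_nat_const; apply: leq_sum => i _; exact: fK. Qed.

Lemma ops_tab_dep_le (I : finType) (A : I -> Type)
    (f : forall i, counted (A i)) K :
  (forall i, ops (f i) <= K)%N -> (ops (tab_dep f) <= #|I| * K)%N.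
Proof. by move=> fK; rewrite -sum_nat_const; apply: leq_sum => i _; exact: fK. Qed.

Context (R : realType).

Lemma result_sumc (I : finType) (f : I -> counted R) :
  result (sumc f) = \sum_i result (f i).
Proof.
have sumE s y : foldl (fun x i => result (z <-- f i ;; addc x z)) y s =
    y + \sum_(i <- s) result (f i).
  elim: s y => [|i s IHs] y; first by rewrite big_nil addr0.
  by rewrite big_cons addrA -IHs.
by rewrite /sumc result_foldc sumE add0r big_enum.
Qed.

Lemma result_prodc (I : finType) (P : pred I) (f : I -> counted R) :
  result (prodc P f) = \prod_(i | P i) result (f i).
Proof.
have prodE s y : foldl (fun x i => result (z <-- f i ;; mulc x z)) y s =
    y * \prod_(i <- s) result (f i).
  elim: s y => [|i s IHs] y; first by rewrite big_nil mulr1.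
  by rewrite big_cons mulrA -IHs.
by rewrite /prodc result_foldc prodE mul1r big_enum.
Qed.

Lemma ops_sumc_le (I : finType) (f : I -> counted R) K :
  (forall i, ops (f i) <= K)%N -> (ops (sumc f) <= #|I| * K.+1)%N.
Proof.
move=> fK; rewrite cardE; apply: ops_foldc_le => y i.
by rewrite /ops /= addn1 ltnS; exact: fK.
Qed.

Lemma ops_prodc_le (I : finType) (P : pred I) (f : I -> counted R) K :
  (forall i, ops (f i) <= K)%N -> (ops (prodc P f) <= #|I| * K.+1)%N.
Proof.
move=> fK; apply: (@leq_trans (size (enum P) * K.+1)); last first.
  by rewrite leq_mul2r -cardE max_card orbT.
apply: ops_foldc_le => y i; rewrite /ops /= addn1 ltnS; exact: fK.
Qed.

Lemma ops_tab_mx_le m n (f : 'I_m -> 'I_n -> counted R) K :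
  (forall i j, ops (f i j) <= K)%N -> (ops (tab_mx f) <= m * n * K)%N.
Proof.
move=> fK; rewrite /tab_mx {1}/ops /= addn0.
have := @ops_tab_le ('I_m * 'I_n)%type R (fun ij => f ij.1 ij.2) K.
by rewrite card_prod !card_ord; apply=> -[].
Qed.

Lemma result_dotc m (u v : 'cV[R]_m) :
  result (dotc u v) = \sum_i u i 0 * v i 0.
Proof. exact: result_sumc. Qed.

Lemma ops_dotc_le m (u v : 'cV[R]_m) : (ops (dotc u v) <= 2 * m)%N.
Proof.
rewrite (leq_trans (@ops_sumc_le _ _ 1 _))//.
by rewrite card_ord mulnC.
Qed.

End CountedPrograms.

(** * Gram-Schmidt factorization *)

Section QR.
Context (R : realType) (m : nat).
Implicit Types (v : 'cV[R]_m) (qs : seq 'cV[R]_m) (r : seq R).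

Definition lincomb r qs : 'cV[R]_m := \sum_(i < size r) nth 0 r i *: nth 0 qs i.

(** The columns of the triangular factor are stored as lists of different
    lengths; missing entries read as 0, so all of them can be summed over the
    same range. *)
Lemma lincomb_widen r qs k :
  (size r <= k)%N -> lincomb r qs = \sum_(i < k) nth 0 r i *: nth 0 qs i.
Proof.
move=> rk; rewrite /lincomb (big_ord_widen k (fun i => nth 0 r i *: nth 0 qs i))//.
rewrite big_mkcond; apply: eq_bigr => i _; case: ltnP => // ri.
by rewrite nth_default// scale0r.
Qed.

Lemma lincomb_rcons r qs q : (size r <= size qs)%N ->
  lincomb r (rcons qs q) = lincomb r qs.
Proof.
move=> rq; apply: eq_bigr => i _.
by rewrite nth_rcons (leq_trans (ltn_ord i) rq).
Qed.

Lemma size_orthogonalize v qs : size (result (orthogonalize v qs)).2 = size qs.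
Proof. by elim: qs v => //= q qs IHqs v; rewrite /result /= IHqs. Qed.

(** Each step subtracts r q from the vector and records r, so the coefficients
    account exactly for what was removed. *)
Lemma orthogonalizeP v qs :
  let w := result (orthogonalize v qs) in v = w.1 + lincomb w.2 qs.
Proof.
elim: qs v => [|q qs IHqs] v /=; first by rewrite /lincomb /= big_ord0 addr0.
rewrite /lincomb /= big_ord_recl /=.
set v' := (X in orthogonalize X qs); set r := (X in X *: q).
rewrite addrCA -(IHqs v'); apply/matrixP => i j; rewrite !mxE /=.
by rewrite (ord1 j) addrC subrK.
Qed.

Lemma ops_orthogonalize_le v qs :
  (ops (orthogonalize v qs) <= size qs * (4 * m))%N.
Proof.
elim: qs v => //= q qs IHqs v; rewrite /ops /= addn0.
set r := (dotc q v).1.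
have hd := ops_dotc_le q v.
set v' := (X in orthogonalize X qs).
have hq := IHqs v'.
rewrite sum_nat_const card_prod !card_ord.
move: hd hq; rewrite /ops => hd hq.
by rewrite mulSn; lia.
Qed.

(** The coefficients of a column only refer to the vectors found so far, hence
    remain valid when vectors are appended. *)
Definition qr_invariant (vs : seq 'cV[R]_m)
    (st : seq 'cV[R]_m * seq (seq R)) : Prop :=
  [/\ size st.2 = size vs, (size st.1 <= size vs)%N &
      forall j, (j < size vs)%N -> (size (nth [::] st.2 j) <= size st.1)%N /\
        nth 0 vs j = lincomb (nth [::] st.2 j) st.1].

Lemma dot_self_eq0 v : \sum_i v i 0 * v i 0 <= 0 -> v = 0.
Proof.
move=> v0; have vge0 i : 0 <= v i 0 * v i 0 by rewrite -expr2 sqr_ge0.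
have /eqP : \sum_i v i 0 * v i 0 = 0.
  by apply/eqP; rewrite eq_le v0 sumr_ge0.
rewrite psumr_eq0// => /allP vi0; apply/matrixP => i j.
have /= := vi0 i (mem_index_enum i).
by rewrite (ord1 j) mxE mulf_eq0 orbb => /eqP.
Qed.

(** When the norm of the remainder vanishes, the remainder is 0 and the column is
    already a combination of the previous vectors; otherwise the remainder is its
    norm times the new vector. *)
Lemma qr_step_invariant vs st v : qr_invariant vs st ->
  qr_invariant (rcons vs v) (result (qr_step st v)).
Proof.
case=> s2 s1 inv; rewrite /qr_step.
set w := orthogonalize v st.1.
have wP : v = w.1.1 + lincomb w.1.2 st.1 := orthogonalizeP v st.1.
have sw : size w.1.2 = size st.1 := size_orthogonalize v st.1.
rewrite /result /=.
have -> : (dotc w.1.1 w.1.1).1 = \sum_i w.1.1 i 0 * w.1.1 i 0 := result_dotc _ _.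
set nn := \sum_i _; case: eqP => [nn0|/eqP nn0].
  have w0 : w.1.1 = 0.
    by apply: dot_self_eq0; rewrite leNgt -sqrtr_gt0 nn0 ltxx.
  split; rewrite /= ?size_rcons ?s2// ?leqW//.
  move=> j; rewrite ltnS leq_eqVlt => /predU1P[->|jvs].
    rewrite nth_rcons s2 ltnn eqxx sw; split=> //.
    by rewrite nth_rcons ltnn eqxx wP w0 add0r.
  by rewrite !nth_rcons s2 jvs; exact: inv.
rewrite /=; set q := (X in rcons st.1 X).
have qE : w.1.1 = Num.sqrt nn *: q.
  apply/matrixP => i j; rewrite !mxE /= (ord1 j) mulrC divfK//.
split; rewrite /= ?size_rcons ?s2 ?ltnS//.
move=> j; rewrite ltnS leq_eqVlt => /predU1P[->|jvs].
  rewrite !nth_rcons s2 ltnn eqxx size_rcons sw; split=> //.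
  rewrite {1}wP qE /lincomb size_rcons big_ord_recr /= !nth_rcons ltnn eqxx.
  rewrite sw ltnn eqxx addrC; congr (_ + _); apply: eq_bigr => i _.
  have iw : (i < size w.1.2)%N by rewrite sw.
  by rewrite !nth_rcons ltn_ord iw.
rewrite !nth_rcons s2 jvs; have [le ->] := inv j jvs.
by rewrite lincomb_rcons// leqW.
Qed.

Lemma qr_fold_invariant vs us st : qr_invariant us st ->
  qr_invariant (us ++ vs) (result (foldc (@qr_step R m) st vs)).
Proof.
rewrite result_foldc.
elim: vs us st => [|v vs IHvs] us st inv /=; first by rewrite cats0.
by rewrite -cat_rcons; apply: IHvs; exact: qr_step_invariant.
Qed.

Lemma qr_mul p (B : 'M[R]_(m, p)) :
  (result (qr B)).1 *m (result (qr B)).2 = B.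
Proof.
have /qr_fold_invariant : qr_invariant [::] ([::], [::]) by [].
move/(_ [seq col j B | j <- enum 'I_p]); rewrite /qr /result /=.
set st := (foldc _ _ _).1 => -[].
rewrite size_map size_enum_ord => s2 s1 inv; apply/matrixP => i j.
have [le] := inv j (ltn_ord j).
rewrite (nth_map j) ?size_enum_ord// nth_ord_enum => /matrixP/(_ i 0).
rewrite (@lincomb_widen _ _ p) ?(leq_trans le)//.
rewrite !mxE => ->; rewrite summxE; apply: eq_bigr => l _.
by rewrite !mxE mulrC.
Qed.

Lemma ops_qr_step_le k st v : (size st.1 <= k)%N ->
  (ops (qr_step st v) <= 4 * m * k + 3 * m + 2)%N.
Proof.
move=> sk; rewrite /qr_step; set w := orthogonalize v st.1.
have hw : (w.2 <= 4 * m * k)%N.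
  rewrite (leq_trans (ops_orthogonalize_le v st.1))// mulnC leq_mul2l sk.
  by rewrite orbT.
rewrite /ops /=; have hd := ops_dotc_le w.1.1 w.1.1.
set nn := dotc _ _ in hd *; rewrite /ops in hd.
case: ifP => _ /=; first by lia.
rewrite sum_nat_const card_prod !card_ord; lia.
Qed.

Lemma ops_qr_fold_le k us vs st : qr_invariant us st ->
  (size us + size vs <= k)%N ->
  (ops (foldc (@qr_step R m) st vs) <=
     size vs * (4 * m * k + 3 * m + 2))%N.
Proof.
elim: vs us st => //= v vs IHvs us st inv sk.
rewrite /ops /= mulSn leq_add//.
  apply: ops_qr_step_le; case: inv => _ s1 _; lia.
by apply: IHvs (qr_step_invariant v inv) _; rewrite size_rcons; lia.
Qed.

Lemma ops_qr_le p (B : 'M[R]_(m, p)) :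
  (ops (qr B) <= p * (4 * m * p + 3 * m + 2))%N.
Proof.
rewrite /qr /ops /= addn0.
have inv0 : qr_invariant [::] ([::], [::]) by [].
have := @ops_qr_fold_le p [::] [seq col j B | j <- enum 'I_p] _ inv0.
by rewrite /= size_map size_enum_ord add0n; apply.
Qed.

End QR.

(** * Mode products and the Tucker data of one leaf *)

Section ModeProducts.
Context (R : realType) (d p : nat).
Local Notation mode := (mode d).
Local Notation midx := (midx d p).
Implicit Types (G : midx -> R) (F : mode -> 'I_p -> R) (B : 'M[R]_p).

Lemma set_modeE (t : midx) m j m' :
  set_mode t m j m' = if m' == m then j else t m'.
Proof. by rewrite /set_mode ffunE. Qed.

(** A Tucker entry, as the full contraction of the core with one vector per
    mode. *)
Definition contract G F : R := \sum_t G t * \prod_m F m (t m).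

(** The mode product is adjoint to the action of B on the vector of that mode.
    Both sides sum over pairs of a multi-index t and an index j, and exchanging j
    with the entry of t at m is an involution of these pairs. *)
Lemma contract_mode_product m B G F :
  contract (result (mode_product m B G)) F =
  contract G (fun m' j => if m' == m then \sum_i F m i * B i j else F m' j).
Proof.
rewrite /contract /mode_product /=.
transitivity (\sum_(x : midx * 'I_p) B (x.1 m) x.2 * G (set_mode x.1 m x.2) *
    (\prod_m' F m' (x.1 m'))).
  rewrite -(pair_bigA _ (fun (t : midx) j => B (t m) j * G (set_mode t m j) *
    (\prod_m' F m' (t m')))) /=.
  apply: eq_bigr => t _; rewrite -mulr_suml; congr (_ * _).
  exact: result_sumc.
(* Both entries of a pair change: t gets j at m, and j becomes the old t m. *)
pose swap (x : midx * 'I_p) : midx * 'I_p := (set_mode x.1 m x.2, x.1 m).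
have swapK : involutive swap.
  case=> t j; rewrite /swap /= set_modeE eqxx; congr (_, _).
  by apply/ffunP => m'; rewrite !set_modeE; case: eqP => // ->.
rewrite (reindex_inj (inv_inj swapK)) /=.
rewrite -(pair_bigA _ (fun (t : midx) j =>
  B (set_mode t m j m) (t m) * G (set_mode (set_mode t m j) m (t m)) *
    (\prod_m' F m' (set_mode t m j m')))) /=.
apply: eq_bigr => t _; rewrite [in RHS](bigD1 m)//= eqxx mulr_suml mulr_sumr.
apply: eq_bigr => j _.
have -> : set_mode (set_mode t m j) m (t m) = t.
  by apply/ffunP => m'; rewrite !set_modeE; case: eqP => // ->.
rewrite (bigD1 m)//= set_modeE eqxx.
under eq_bigr => m' /negPf m'm do rewrite set_modeE m'm.
under [in RHS]eq_bigr => m' /negPf m'm do rewrite m'm.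
by ring.
Qed.

(** Distinct modes do not interfere, so the products can be moved to the vectors
    one mode at a time. *)
Lemma contract_mode_products (B : mode -> 'M[R]_p) G F (s : seq mode) :
  uniq s ->
  contract (result (foldc (fun G' m => mode_product m (B m) G') G s)) F =
  contract G (fun m j => if m \in s then \sum_i F m i * B m i j else F m j).
Proof.
elim: s G => [|m s IHs] G //= /andP[ms us].
(* The head of the list is the first mode to be multiplied. *)
rewrite -[LHS]/(contract (result (foldc (fun G' m => mode_product m (B m) G')
  (result (mode_product m (B m) G)) s)) F) IHs// contract_mode_product.
apply: eq_bigr => t _; congr (_ * _); apply: eq_bigr => m' _.
rewrite in_cons; case: eqP => [->|//]; rewrite (negPf ms) /=.
by [].
Qed.

Lemma card_midx : #|{: midx}| = (p ^ (2 * d))%N.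
Proof.
rewrite card_dep_ffun /= foldrE big_map big_enum /=.
under eq_bigr do rewrite card_ord.
by rewrite prod_nat_const card_sum !card_ord addnn mul2n.
Qed.

Lemma ops_mode_product_le m B G :
  (ops (mode_product m B G) <= p ^ (2 * d) * (p * 2))%N.
Proof.
rewrite -card_midx; apply: ops_tab_le => t.
by rewrite (leq_trans (@ops_sumc_le _ _ _ 1 _))// card_ord.
Qed.

End ModeProducts.

(** * Leaf blocks *)

Section Leaves.
Context (R : realType) (d n : nat).
Local Notation point := (d.-tuple (measurableTypeR R)).
Context (a : point -> R) (k : point -> point -> R) (p : nat).
Local Notation node := (node d n).

Lemma result_cellvolumec : result (cellvolumec R d n) = meshsize R n ^+ d.
Proof. by rewrite /cellvolumec result_prodc prodr_const cardT size_enum_ord. Qed.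

Lemma ops_cellvolumec_le : (ops (cellvolumec R d n) <= d)%N.
Proof.
by rewrite (leq_trans (@ops_prodc_le _ _ _ _ 0 _))// card_ord muln1.
Qed.

Lemma result_entryc (i j : grid d n) : result (entryc a k i j) = mxA a k i j.
Proof.
rewrite /entryc /mxA /kernel_entry -result_cellvolumec eq_sym.
case: eqP => [->|_]; rewrite /result /=.
  by rewrite mulr1 [_^-1 * _]mulrC.
by rewrite mulr0 add0r.
Qed.

Lemma ops_gridpointc_le (i : grid d n) : (ops (gridpointc R i) <= 2 * d)%N.
Proof.
rewrite /gridpointc /ops /= addn0 sum_nat_const card_ord; lia.
Qed.

Lemma ops_entryc_le (i j : grid d n) : (ops (entryc a k i j) <= 5 * d + 5)%N.
Proof.
have hv := ops_cellvolumec_le.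
have hi := ops_gridpointc_le i.
have hj := ops_gridpointc_le j.
move: hv hi hj; rewrite /entryc /ops => hv hi hj.
case: eqP => _; move: hv hi hj; rewrite /= !addn0; lia.
Qed.

Lemma card_local (tau : node) : #|{: local tau}| = (\prod_l #|tau l|)%N.
Proof.
rewrite card_dep_ffun /= foldrE big_map big_enum /=.
by apply: eq_bigr => l _; rewrite card_ord.
Qed.

Lemma ops_dense_leaf_le (tau sigma : node) :
  (ops (dense_leaf a k tau sigma) <=
    (\prod_l #|tau l|) * (\prod_l #|sigma l|) * (5 * d + 5))%N.
Proof.
rewrite -mulnA -!card_local.
rewrite -[ops _]/(ops (tab (fun i : local tau => tab (fun j : local sigma =>
  entryc a k (global i) (global j)))) + 0)%N addn0.
apply: ops_tab_le => i; apply: ops_tab_le => j; exact: ops_entryc_le.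
Qed.

Lemma result_interpc (A : {set 'I_n}) :
  let F := result (interpc R p A) in
  (forall t, F.1 t = Defs.chebyshev (left_end R A) (right_end R A) t) /\
  (forall i t, F.2 i t = Defs.lagrange (left_end R A) (right_end R A) t
     (((enum_val i : 'I_n)%:R + 2^-1) * meshsize R n)).
Proof.
split=> // i t; rewrite mxE.
exact: result_prodc.
Qed.

Lemma ops_interpc_le (A : {set 'I_n}) :
  (ops (interpc R p A) <= 2 + 9 * p + 2 * #|A| + #|A| * p * (4 * p))%N.
Proof.
rewrite /interpc /mulc 5!ops_bind ops_ret addn0 !ops_op.
set xi := tab _; set x := tab _; set U := tab_mx _.
have hxi : (ops xi <= p * 9)%N.
  by rewrite -{2}(card_ord p); exact: ops_tab_le.
have hx : (ops x <= #|A| * 2)%N.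
  by rewrite -{2}(card_ord #|A|); exact: ops_tab_le.
have hU : (ops U <= #|A| * p * (4 * p))%N.
  apply: ops_tab_mx_le => i j.
  by rewrite (leq_trans (@ops_prodc_le _ _ _ _ 3 _))// card_ord mulnC.
lia.
Qed.

(** Moving all the mode products from the core to the factors turns W into
    W R = U, whose entries are the values of the Lagrange functions. *)
Lemma adm_leaf_tucker (tau sigma : node) :
  exists X : tucker R tau sigma, [/\ result (adm_leaf k p tau sigma) = HAdm X,
    forall m, rank X m = p &
    forall i j, tucker_entry X i j =
      interp_entry k p tau sigma (global i) (global j)].
Proof.
rewrite /adm_leaf /result /=.
set G1 := foldc _ _ _.
eexists; split; [reflexivity|by []|move=> i j].
set W := fun l => (qr (interpc R p (tau l)).1.2).1.1.
set Q := fun l => (qr (interpc R p (sigma l)).1.2).1.1.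
pose F (m : mode d) : 'I_p -> R :=
  match m with inl l => W l (i l) | inr l => Q l (j l) end.
transitivity (contract G1.1 F).
  rewrite /tucker_entry /contract /=; apply: eq_bigr => t _.
  by rewrite big_sumType /= mulrA.
rewrite /G1.
pose B (m : mode d) : 'M[R]_p :=
  match m with
  | inl l => (qr (interpc R p (tau l)).1.2).1.2
  | inr l => (qr (interpc R p (sigma l)).1.2).1.2
  end.
rewrite (contract_mode_products B)/= ?enum_uniq//.
rewrite /contract /interp_entry -result_cellvolumec.
pose split (t : midx d p) : {ffun 'I_d -> 'I_p} * {ffun 'I_d -> 'I_p} :=
  ([ffun l => t (inl l)], [ffun l => t (inr l)]).
pose join (x : {ffun 'I_d -> 'I_p} * {ffun 'I_d -> 'I_p}) : midx d p :=
  [ffun m => match m with inl l => x.1 l | inr l => x.2 l end].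
have joinK : cancel join split.
  by case=> t s; congr pair; apply/ffunP => l; rewrite !ffunE.
have splitK : cancel split join.
  by move=> t; apply/ffunP => -[] l; rewrite !ffunE.
rewrite pair_bigA mulr_sumr (reindex split)/=; last first.
  by exists join => x _; [exact: splitK|exact: joinK].
apply: eq_bigr => t _.
rewrite big_sumType /= -!mulrA; congr (_ * (_ * (_ * _))).
- congr k; apply: eq_mktuple => l; rewrite ffunE; exact: (result_interpc _).1.
- apply: eq_bigr => l _; rewrite mem_enum /= ffunE.
  have := qr_mul (interpc R p (tau l)).1.2 => /matrixP/(_ (i l) (t (inl l))).
  rewrite mxE => ->; rewrite (result_interpc (tau l)).2.
  by rewrite /Defs.coord /gridpoint tnth_mktuple ffunE.
- apply: eq_bigr => l _; rewrite mem_enum /= ffunE.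
  have := qr_mul (interpc R p (sigma l)).1.2 => /matrixP/(_ (j l) (t (inr l))).
  rewrite mxE => ->; rewrite (result_interpc (sigma l)).2.
  by rewrite /Defs.coord /gridpoint tnth_mktuple ffunE.
Qed.

(** The 2d interpolation matrices and their QR factorizations are responsible for
    the term in M, the core and its 2d mode products for the other one.  In each
    of the 2d modes the interpolation matrix costs at most 17 M p^2 operations
    and its factorization 9 M p^2, whence 52 = 2 (17 + 9). *)
Lemma ops_adm_leaf_le (tau sigma : node) M : (0 < d)%N -> (0 < p)%N -> (0 < M)%N ->
  (forall l, #|tau l| <= M)%N -> (forall l, #|sigma l| <= M)%N ->
  (ops (adm_leaf k p tau sigma) <= 52 * d * (p ^ (2 * d + 1) + M * p ^ 2))%N.
Proof.
move=> d0 p0 M0 tauM sigmaM.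
have hF (nu : node) : (forall l, #|nu l| <= M)%N ->
    (ops (tab_dep (fun l => interpc R p (nu l))) <= d * (17 * (M * p ^ 2)))%N.
  move=> nuM; rewrite -[X in (_ <= X * _)%N](card_ord d); apply: ops_tab_dep_le => l.
  rewrite (leq_trans (ops_interpc_le _))//; have := nuM l; nia.
have hQ (nu : node) : (forall l, #|nu l| <= M)%N ->
    (ops (tab_dep (fun l => qr (interpc R p (nu l)).1.2)) <= d * (9 * (M * p ^ 2)))%N.
  move=> nuM; rewrite -[X in (_ <= X * _)%N](card_ord d); apply: ops_tab_dep_le => l.
  rewrite (leq_trans (ops_qr_le _))//; have := nuM l; nia.
have hM (B : mode d -> 'M[R]_p) (G : midx d p -> R) :
  (ops (foldc (fun G' m => mode_product m (B m) G') G (enum {: mode d}))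
    <= 4 * d * p ^ (2 * d + 1))%N.
  apply: (leq_trans (@ops_foldc_le _ _ _ _ _ (p ^ (2 * d) * (p * 2)) _)).
    by move=> y m; exact: ops_mode_product_le.
  rewrite -cardT card_sum !card_ord addn1 expnS; lia.
have := hF tau tauM; have := hF sigma sigmaM.
have := ops_cellvolumec_le.
have hT (f : midx d p -> counted R) : (forall t, ops (f t) <= 1)%N ->
    (ops (tab f) <= p ^ (2 * d) * 1)%N.
  by rewrite -card_midx; exact: ops_tab_le.
rewrite /adm_leaf !ops_bind ops_ret addn0.
set G := (X in (_ + (_ + (ops X + _)) <= _)%N).
have : (ops G <= p ^ (2 * d) * 1)%N by exact: hT.
set WR := (X in (_ + (_ + (_ + (ops X + _))) <= _)%N).
have : (ops WR <= d * (9 * (M * p ^ 2)))%N by exact: hQ.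
set QT := (X in (_ + (_ + (_ + (_ + (ops X + _)))) <= _)%N).
have : (ops QT <= d * (9 * (M * p ^ 2)))%N by exact: hQ.
set G0 := tab (fun t => mulc _ _).
have : (ops G0 <= p ^ (2 * d) * 1)%N by exact: hT.
set G1 := foldc _ _ _.
have : (ops G1 <= 4 * d * p ^ (2 * d + 1))%N by exact: hM.
have -> : (p ^ (2 * d + 1) = p ^ (2 * d) * p)%N by rewrite addn1 expnSr.
have P0 : (0 < p ^ (2 * d))%N by rewrite expn_gt0 p0.
have : (p ^ (2 * d) <= d * (p ^ (2 * d) * p))%N.
  by rewrite mulnCA leq_pmulr// muln_gt0 d0.
have : (d <= d * (p ^ (2 * d) * p))%N by rewrite leq_pmulr// muln_gt0 P0.
move: (M * p ^ 2)%N (p ^ (2 * d))%N => Y P; lia.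
Qed.

End Leaves.

(** * The block cluster tree and the matrix it represents *)

Section Partition.
Context (d n : nat).
Local Notation node := (node d n).
Local Notation grid := (grid d n).
Implicit Types (tau sigma c : node) (A : {set 'I_n}).

(** Which half of A contains x, as a function of x: membership in a part of a
    node then says that these bits have prescribed values. *)
Definition second_half A (x : 'I_n) : bool := (uphalf #|A| <= index x (enum A))%N.

Lemma in_half A b x :
  (x \in Defs.half A b) = (x \in A) && (b == second_half A x).
Proof.
rewrite /Defs.half /second_half leqNgt.
have [xA|xA] /= := boolP (x \in A); last first.
  by apply/negbTE; apply: contra xA; case: b; rewrite inE => xs;
    rewrite -mem_enum ?(mem_drop xs)// (mem_take xs).
have xe : x \in enum A by rewrite mem_enum.
have := enum_uniq A; have := xe; rewrite -{1 2}(cat_take_drop (uphalf #|A|) (enum A)).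
rewrite mem_cat cat_uniq => xtd /and3P[_ /hasPn disj _].
case: b; rewrite inE -(in_take _ xe); last by case: (_ \in take _ _).
by case/orP: xtd => [xt|xd];
  [rewrite xt; apply/negbTE; apply/negP => /disj; rewrite /= xt|
   rewrite xd; have := disj _ xd => /= ->].
Qed.

(** The only part of tau that can contain i. *)
Definition child tau (i : grid) : node :=
  [ffun l => Defs.half (tau l) (second_half (tau l) (i l))].

Lemma mem_child tau i : i \in points tau -> i \in points (child tau i).
Proof.
rewrite !inE => /forallP itau; apply/forallP => l.
by rewrite ffunE in_half itau eqxx.
Qed.

Lemma child_mem_parts tau i : i \in points tau -> child tau i \in Defs.parts tau.
Proof.
move=> itau; rewrite mem_filter; apply/andP; split.
  by apply/set0Pn; exists i; exact: mem_child.
apply/mapP; exists [ffun l => second_half (tau l) (i l)]; first by rewrite mem_enum.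
by apply/ffunP => l; rewrite !ffunE.
Qed.

Lemma parts_child tau c i : c \in Defs.parts tau -> i \in points c ->
  i \in points tau /\ c = child tau i.
Proof.
rewrite mem_filter => /andP[_ /mapP[b _ ->]]; rewrite !inE => /forallP ic.
have icl l : (i l \in tau l) && (b l == second_half (tau l) (i l)).
  by have := ic l; rewrite ffunE in_half.
split; first by apply/forallP => l; have /andP[] := icl l.
by apply/ffunP => l; rewrite !ffunE; have /andP[_ /eqP ->] := icl l.
Qed.

Lemma parts_nonempty tau c : c \in Defs.parts tau -> points c != finset.set0.
Proof. by rewrite mem_filter => /andP[]. Qed.

Lemma parts_neq_nil tau : points tau != finset.set0 -> Defs.parts tau != [::].
Proof.
case/set0Pn => i /child_mem_parts.
by case: (Defs.parts tau).
Qed.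

Section BlockTree.
Context (adm : node -> node -> Prop) (N0 : nat).

Definition partition_block (f : nat) tau sigma : btree d n :=
  block_tree adm (uniform_partition f N0 tau) (uniform_partition f N0 sigma).

(** The three cases of the recursion.  The nonempty parts of a nonempty node are
    never an empty list, so a dense leaf only arises from a small node or from
    lack of fuel. *)
Variant partition_block_spec (f : nat) tau sigma : btree d n -> Prop :=
| PartitionBlockAdm of adm tau sigma :
    partition_block_spec f tau sigma (BAdm tau sigma)
| PartitionBlockDense of ~ adm tau sigma
    & [\/ f = 0%N, (#|points tau| <= N0)%N | (#|points sigma| <= N0)%N] :
    partition_block_spec f tau sigma (BDense tau sigma)
| PartitionBlockNode f' of ~ adm tau sigma & f = f'.+1
    & (N0 < #|points tau|)%N & (N0 < #|points sigma|)%N :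
    partition_block_spec f tau sigma
      (BNode tau sigma [seq partition_block f' c c' |
                         c <- Defs.parts tau, c' <- Defs.parts sigma]).

Lemma partition_blockP f tau sigma : points tau != finset.set0 ->
  points sigma != finset.set0 ->
  partition_block_spec f tau sigma (partition_block f tau sigma).
Proof.
move=> tau0 sigma0; rewrite /partition_block.
have partitionE g nu : uniform_partition g N0 nu = CNode nu
  (if (#|points nu| <= N0)%N then [::]
   else if g is g'.+1 then [seq uniform_partition g' N0 c | c <- Defs.parts nu]
   else [::]) by case: g.
rewrite !partitionE /=.
case: asboolP => [|nadm]; first exact: PartitionBlockAdm.
case: (leqP #|points tau| N0) => tauN; first by apply: PartitionBlockDense => //; apply: Or32.
case: (leqP #|points sigma| N0) => sigmaN.
  by rewrite orbT; apply: PartitionBlockDense => //; apply: Or33.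
case: f => [|f]; first by apply: PartitionBlockDense => //; apply: Or31.
rewrite /nilp !size_map !size_eq0 (negPf (parts_neq_nil tau0)).
rewrite (negPf (parts_neq_nil sigma0)) /=.
have -> : [seq [seq block_tree adm t s | s <- [seq uniform_partition f N0 c |
      c <- Defs.parts sigma]] | t <- [seq uniform_partition f N0 c |
      c <- Defs.parts tau]] =
    [seq [seq partition_block f c c' | c' <- Defs.parts sigma] |
      c <- Defs.parts tau].
  by rewrite -map_comp; apply: eq_map => c /=; rewrite -map_comp.
exact: PartitionBlockNode.
Qed.

End BlockTree.
End Partition.

Lemma foldr_and_allpairs (S T : eqType) U (P : U -> Prop) (F : S -> T -> U) s t :
  (forall x y, x \in s -> y \in t -> P (F x y)) ->
  foldr (fun u A => P u /\ A) True [seq F x y | x <- s, y <- t].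
Proof.
elim: s => [|x s IHs] //= PF; rewrite foldr_cat.
have : foldr (fun u A => P u /\ A) True [seq F x y | x <- s, y <- t].
  by apply: IHs => x' y x's yt; apply: PF => //; rewrite in_cons x's orbT.
move: (foldr _ True _) => Z PZ.
have : forall y, y \in t -> P (F x y) by move=> y; apply: PF; rewrite mem_head.
elim: t {PF IHs} => [|y t IHt] //= Pt; split; first by apply: Pt; rewrite mem_head.
by apply: IHt => z zt; apply: Pt; rewrite in_cons zt orbT.
Qed.

Lemma foldr_and_impl T (P Q : T -> Prop) (s : seq T) :
  foldr (fun x A => (P x -> Q x) /\ A) True s ->
  foldr (fun x A => P x /\ A) True s -> foldr (fun x A => Q x /\ A) True s.
Proof. by elim: s => //= x s IHs [PQ /IHs IH] [/PQ Qx /IH]. Qed.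

Lemma foldr_and_map S T (f : S -> T) (P : T -> Prop) (s : seq S) :
  foldr (fun x A => P x /\ A) True [seq f x | x <- s] =
  foldr (fun x A => P (f x) /\ A) True s.
Proof. by elim: s => //= x s ->. Qed.

(** The children of a block are stored in a list, so the generated induction
    principle gives no hypothesis for them. *)
Lemma btree_nested_ind d n (P : btree d n -> Prop) :
  (forall tau sigma, P (BAdm tau sigma)) ->
  (forall tau sigma, P (BDense tau sigma)) ->
  (forall tau sigma ts, foldr (fun t A => P t /\ A) True ts ->
     P (BNode tau sigma ts)) ->
  forall T, P T.
Proof.
move=> Padm Pdense Pnode; fix IH 1 => -[tau sigma|tau sigma|tau sigma ts].
- exact: Padm.
- exact: Pdense.
- by apply: Pnode; elim: ts => //= t ts IHts; split.
Qed.

(** * Correctness of the construction *)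

Section Correctness.
Context (R : realType) (d n : nat).
Local Notation point := (d.-tuple (measurableTypeR R)).
Context (a : point -> R) (k : point -> point -> R) (p : nat).
Local Notation node := (node d n).
Local Notation grid := (grid d n).
Implicit Types (T : btree d n) (M : grid -> grid -> R).

Lemma result_construct_node (tau sigma : node) ts :
  result (construct a k p (BNode tau sigma ts)) =
  HNode tau sigma [seq result (construct a k p t) | t <- ts].
Proof. by rewrite map_comp -result_seqc. Qed.

Lemma construct_adm (tau sigma : node) :
  construct a k p (BAdm tau sigma) = adm_leaf k p tau sigma.
Proof. by []. Qed.

Lemma structure_construct T : Defs.structure (result (construct a k p T)) = T.
Proof.
elim/btree_nested_ind: T => [tau sigma|//|tau sigma ts IH].
  by rewrite construct_adm; have [X [-> _ _]] := adm_leaf_tucker k p tau sigma.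
rewrite result_construct_node /= -map_comp; congr BNode.
by elim: ts IH => //= t ts IHts [-> /IHts ->].
Qed.

Lemma rank_construct T :
  all_data (fun _ _ X => forall m, (rank X m <= p)%N) (fun _ _ _ => True)
    (result (construct a k p T)).
Proof.
elim/btree_nested_ind: T => [tau sigma|//|tau sigma ts IH].
  rewrite construct_adm; have [X [-> rX _]] := adm_leaf_tucker k p tau sigma.
  by move=> m; rewrite rX.
by rewrite result_construct_node /= foldr_and_map.
Qed.

Lemma global_points (tau : node) (i : local tau) : global i \in points tau.
Proof. by rewrite inE; apply/forallP => l; rewrite ffunE enum_valP. Qed.

Lemma entries_construct T M : interpolates a k p T M ->
  all_data (fun tau sigma X => forall i j,
      M (global i) (global j) = tucker_entry X i j)
    (fun tau sigma D => forall i j, M (global i) (global j) = D i j)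
    (result (construct a k p T)).
Proof.
rewrite /interpolates; elim/btree_nested_ind: T => [tau sigma|tau sigma|tau sigma ts IH].
- rewrite construct_adm; have [X [-> _ XE]] := adm_leaf_tucker k p tau sigma.
  move=> ME i j.
  by rewrite XE ME// global_points.
- move=> /= ME i j.
  by rewrite ME ?global_points// -result_entryc.
- rewrite result_construct_node /= foldr_and_map; exact: foldr_and_impl.
Qed.

(** The statement quantifies over all matrices that agree with M on the block, so
    that the matrices of the children can be glued: the pair (i, j) lies in the
    block of exactly one pair of parts, and the value is taken from there. *)
Lemma interpolates_partition_block adm N0 f tau sigma :
  points tau != finset.set0 -> points sigma != finset.set0 ->
  exists M, forall M',
    (forall i j, i \in points tau -> j \in points sigma -> M' i j = M i j) ->
    interpolates a k p (partition_block adm N0 f tau sigma) M'.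
Proof.
elim: f tau sigma => [|f IHf] tau sigma tau0 sigma0.
  case: partition_blockP => // [_|_ _].
    by exists (interp_entry k p tau sigma) => M'.
  by exists (mxA a k) => M'.
case: partition_blockP => // [_|_ _|f' _ [<-] _ _].
- by exists (interp_entry k p tau sigma) => M'.
- by exists (mxA a k) => M'.
have /choice[Mc McP] : forall x : node * node, exists M,
    points x.1 != finset.set0 -> points x.2 != finset.set0 ->
    forall M', (forall i j, i \in points x.1 -> j \in points x.2 ->
      M' i j = M i j) ->
    interpolates a k p (partition_block adm N0 f x.1 x.2) M'.
  move=> [c c'] /=.
  have [c0|c0] := boolP (points c != finset.set0); last by exists (mxA a k).
  have [c'0|c'0] := boolP (points c' != finset.set0); last by exists (mxA a k).
  by have [M MP] := IHf c c' c0 c'0; exists M.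
exists (fun i j => Mc (child tau i, child sigma j) i j) => M' M'E.
apply: foldr_and_allpairs => c c' cp c'p.
apply: (McP (c, c')) => [||i j /= ic jc'].
- exact: parts_nonempty cp.
- exact: parts_nonempty c'p.
have [itau ->] := parts_child cp ic; have [jsigma ->] := parts_child c'p jc'.
exact: M'E.
Qed.

Lemma points_root : (0 < n)%N ->
  points ([ffun=> finset.setT] : node) != finset.set0.
Proof.
move=> n0; apply/set0Pn; exists [ffun=> Ordinal n0].
by rewrite inE; apply/forallP => l; rewrite !ffunE inE.
Qed.

Lemma construct_correct adm N0 : (0 < n)%N ->
  let T := block_cluster_tree adm N0 in
  exists M : grid -> grid -> R,
    HTLR_matrix p T (result (construct a k p T)) M /\ interpolates a k p T M.
Proof.
move=> n0 T; have root0 := points_root n0.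
have [M MP] := interpolates_partition_block adm N0 #|{: grid}| root0 root0.
have {}MP := MP M (fun i j _ _ => erefl); exists M; split=> //; split.
- exact: structure_construct.
- exact: rank_construct.
- exact: entries_construct.
Qed.

End Correctness.

(** * Nodes as boxes of dyadic position *)

Section Intervals.
Context (n : nat).

(** The position b of an interval of level L is read in binary, its last digit
    telling which half of its parent it is; this is where the interval starts.
    The intervals of one level are consecutive, so the next one starts where it
    ends. *)
Fixpoint endpoint (L b : nat) : nat :=
  if L is L'.+1 then
    if odd b then
      endpoint L' b./2 + uphalf (endpoint L' b./2.+1 - endpoint L' b./2)
    else endpoint L' b./2
  else b * n.

(** Halving preserves that all the sizes of one level lie in {q, q + 1}: if
    q = 2r or q = 2r + 1, then both halves have size r or r + 1. *)
Lemma endpoint_step L b :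
  (endpoint L b + n %/ 2 ^ L <= endpoint L b.+1 <= endpoint L b + n %/ 2 ^ L + 1)%N.
Proof.
elim: L b => [|L IHL] b; first by rewrite /= expn0 divn1 mulSn; lia.
have -> : (n %/ 2 ^ L.+1 = (n %/ 2 ^ L) %/ 2)%N by rewrite expnSr divnMA.
move: (IHL b./2); rewrite /= !uphalf_half.
case: (odd b); rewrite /= ?add1n ?add0n.
  move: (endpoint L _) (endpoint L _) (n %/ 2 ^ L)%N => x y q.
  have := odd_double_half (y - x); case: (odd _) => /=; lia.
move: (endpoint L _) (endpoint L _) (n %/ 2 ^ L)%N => x y q.
have := odd_double_half (y - x); case: (odd _) => /=; lia.
Qed.

Lemma endpoint_step_ge L b m :
  (endpoint L b + m * (n %/ 2 ^ L) <= endpoint L (b + m))%N.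
Proof.
elim: m => [|m IHm]; first by rewrite !addn0.
rewrite addnS mulSn; have := endpoint_step L (b + m); lia.
Qed.

Lemma endpoint_leq L b c : (b <= c)%N -> (endpoint L b <= endpoint L c)%N.
Proof.
move=> bc; rewrite -(subnKC bc).
by rewrite (leq_trans _ (endpoint_step_ge L b (c - b)))// leq_addr.
Qed.

Lemma endpoint_le L b : (b <= 2 ^ L)%N -> (endpoint L b <= n)%N.
Proof.
elim: L b => [|L IHL] b; first by case: b => [|[|//]]; rewrite /= ?mul1n.
rewrite expnS => bL /=; case: (boolP (odd b)) => ob; last by apply: IHL; lia.
have h1 : (endpoint L b./2.+1 <= n)%N by apply: IHL; lia.
have h2 := endpoint_leq L (leqnSn b./2); rewrite uphalf_half; lia.
Qed.

Definition interval (s e : nat) : {set 'I_n} := [set x : 'I_n | s <= x < e]%N.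

Lemma enum_interval s e : (e <= n)%N ->
  [seq val x | x <- enum (interval s e)] = iota s (e - s).
Proof.
move=> en; apply: (irr_sorted_eq ltn_trans ltnn).
- rewrite sorted_map /enum_mem; apply: sorted_filter.
    by move=> y x z; exact: ltn_trans.
  by rewrite -sorted_map -enumT val_enum_ord iota_ltn_sorted.
- exact: iota_ltn_sorted.
move=> x; rewrite mem_iota; apply/mapP/idP => [[y]|].
  by rewrite mem_enum inE => /andP[sy ye] ->; rewrite -[val y]/(y : nat); lia.
move=> xse; have xn : (x < n)%N by lia.
by exists (Ordinal xn) => //; rewrite mem_enum inE /=; lia.
Qed.

Lemma card_interval s e : (e <= n)%N -> #|interval s e| = (e - s)%N.
Proof.
by move=> en; rewrite cardE -(size_map val) enum_interval// size_iota.
Qed.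

Lemma half_interval s e b : (s <= e <= n)%N ->
  Defs.half (interval s e) b =
  if b then interval (s + uphalf (e - s)) e else interval s (s + uphalf (e - s)).
Proof.
move=> /andP[se en]; have mid : (s + uphalf (e - s) <= e)%N by rewrite uphalf_half; lia.
rewrite /Defs.half card_interval//; case: b; apply/setP => x; rewrite inE;
  rewrite -(mem_map val_inj) ?map_drop ?map_take enum_interval//.
  by rewrite drop_iota mem_iota [in RHS]inE -[val x]/(x : nat); lia.
by rewrite take_iota mem_iota [in RHS]inE -[val x]/(x : nat); lia.
Qed.

End Intervals.

Section Boxes.
Context (d n : nat).
Local Notation node := (node d n).
Implicit Types (L : nat) (b c : 'I_d -> nat).

Definition box L b : node :=
  [ffun l => interval n (endpoint n L (b l)) (endpoint n L (b l).+1)].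

Lemma card_box L b l : (b l < 2 ^ L)%N ->
  (n %/ 2 ^ L <= #|box L b l| <= (n %/ 2 ^ L).+1)%N.
Proof.
move=> bL; rewrite ffunE card_interval; last exact: endpoint_le.
have := endpoint_step n L (b l).
move: (endpoint n L _) (endpoint n L _) (n %/ 2 ^ L)%N => s e q; lia.
Qed.

Lemma card_points (tau : node) : #|points tau| = (\prod_l #|tau l|)%N.
Proof.
rewrite -card_local; rewrite card_dep_ffun /= foldrE big_map big_enum /=.
transitivity #|family (fun l => mem (tau l))|.
  by apply: eq_card => i; rewrite inE; apply/forallP/familyP.
rewrite card_family foldrE big_map big_enum /=.
by apply: eq_bigr => l _; rewrite card_ord.
Qed.

Definition child_position b (e : {ffun 'I_d -> bool}) : 'I_d -> nat :=
  fun l => (2 * b l + e l)%N.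

Lemma child_position_lt L b e :
  (forall l, b l < 2 ^ L)%N -> (forall l, child_position b e l < 2 ^ L.+1)%N.
Proof.
by move=> bL l; have := bL l; rewrite /child_position expnS; case: (e l); lia.
Qed.

(** The first piece gets the extra index of an odd interval, in agreement with
    the rounded-up half in [endpoint]. *)
Lemma parts_box L b : (forall l, b l < 2 ^ L)%N ->
  Defs.parts (box L b) =
  [seq c <- [seq box L.+1 (child_position b e) | e <- enum {ffun 'I_d -> bool}]
     | points c != finset.set0].
Proof.
move=> bL; rewrite /Defs.parts; congr (seq.filter _ _); apply: eq_map => e; apply/ffunP => l; rewrite !ffunE.
rewrite half_interval; last first.
  by rewrite endpoint_le// andbT endpoint_leq.
rewrite /child_position /=.
case: (e l) => /=.
  by rewrite addn1 mul2n /= doubleK odd_double /= uphalf_double.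
by rewrite addn0 mul2n odd_double doubleK /= uphalf_double.
Qed.

Lemma root_box : ([ffun=> finset.setT] : node) = box 0 (fun=> 0%N).
Proof.
apply/ffunP => l; rewrite !ffunE /interval /= mul1n; apply/setP => x.
by rewrite !inE ltn_ord.
Qed.

End Boxes.

(** * Admissibility of distant boxes *)

Section Geometry.
Context (R : realType) (d n : nat).
Local Notation point := (d.-tuple (measurableTypeR R)).
Local Notation node := (node d n).
Local Notation h := (meshsize R n).
Implicit Types (x y : point) (tau sigma : node) (A B : set point).

Lemma euclid_ge x y l : `|Defs.coord x l - Defs.coord y l| <= euclid x y.
Proof.
rewrite -sqrtr_sqr ler_sqrt ?sumr_ge0// => [|? _]; last exact: sqr_ge0.
by rewrite (bigD1 l)//= lerDl sumr_ge0// => ? _; exact: sqr_ge0.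
Qed.

Lemma euclid_le x y r : 0 <= r ->
  (forall l, `|Defs.coord x l - Defs.coord y l| <= r) ->
  euclid x y <= Num.sqrt d%:R * r.
Proof.
move=> r0 xyr; rewrite -[X in _ * X](ger0_norm r0) -sqrtr_sqr -sqrtrM//.
rewrite ler_wsqrtr//.
rewrite mulr_natl -[X in _ *+ X]card_ord -sumr_const; apply: ler_sum => l _.
by rewrite -real_normK ?num_real// lerXn2r ?nnegrE.
Qed.

Lemma diam_le A r : 0 <= r ->
  (forall x y l, A x -> A y -> `|Defs.coord x l - Defs.coord y l| <= r) ->
  diam A <= Num.sqrt d%:R * r.
Proof.
move=> r0 Ar; have [[s As]|/set0P/negP/negPn/eqP A0] :=
  pselect ([set r | exists x y, [/\ A x, A y & r = euclid x y]] !=set0)%classic.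
  apply: ge_sup; first by exists s.
  by move=> _ [x [y [Ax Ay ->]]]; apply: euclid_le => // l; exact: Ar.
by rewrite /diam A0 sup0 mulr_ge0// sqrtr_ge0.
Qed.

Lemma dist_ge A B r l : (A !=set0)%classic -> (B !=set0)%classic ->
  (forall x y, A x -> B y -> r <= `|Defs.coord x l - Defs.coord y l|) ->
  r <= dist A B.
Proof.
move=> [x0 Ax0] [y0 By0] ABr; apply: lb_le_inf; first by exists (euclid x0 y0), x0, y0.
by move=> _ [x [y [Ax By ->]]]; rewrite (le_trans (ABr x y Ax By))// euclid_ge.
Qed.

Lemma Omega_neq0 tau : points tau != finset.set0 -> (@Omega R d n tau !=set0)%classic.
Proof.
case/set0Pn => i itau; exists [tuple (i l)%:R * h | l < d], i => // l.
rewrite /Defs.coord tnth_mktuple lexx/= ler_wpM2r ?invr_ge0 ?ler0n//.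
by rewrite ler_nat.
Qed.

Lemma Omega_box L b x l : @Omega R d n (box n L b) x ->
  (endpoint n L (b l))%:R * h <= Defs.coord x l <= (endpoint n L (b l).+1)%:R * h.
Proof.
case=> i; rewrite inE => /forallP/(_ l); rewrite ffunE inE => /andP[si ie] /(_ l).
move=> /andP[ix xi]; rewrite (le_trans _ ix) ?(le_trans xi)//.
  by rewrite ler_wpM2r ?invr_ge0 ?ler0n// ler_nat.
by rewrite ler_wpM2r ?invr_ge0 ?ler0n// ler_nat.
Qed.

Lemma Omega_box_width L b x y l : @Omega R d n (box n L b) x -> @Omega R d n (box n L b) y ->
  `|Defs.coord x l - Defs.coord y l| <= (n %/ 2 ^ L).+1%:R * h.
Proof.
move=> /(Omega_box l) /andP[sx xe] /(Omega_box l) /andP[sy ye].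
have /andP[_] := endpoint_step n L (b l); rewrite addn1 -addnS -(ler_nat R) natrD => se.
have h0 : 0 <= h by rewrite invr_ge0.
have := ler_wpM2r h0 se; rewrite mulrDl ler_norml => seh.
by apply/andP; split; lra.
Qed.

(** The positions leave room for at most one interval between them. *)
Definition nearby (b c : nat) : bool := (b <= c + 2)%N && (c <= b + 2)%N.

(** Two whole intervals of at least q indices lie between the boxes in coordinate
    l, and 2q >= q + 1 as q > 0. *)
Lemma Omega_box_gap L b c x y l : (0 < n %/ 2 ^ L)%N -> ~~ nearby (b l) (c l) ->
  @Omega R d n (box n L b) x -> @Omega R d n (box n L c) y ->
  (n %/ 2 ^ L).+1%:R * h <= `|Defs.coord x l - Defs.coord y l|.
Proof.
move=> q0 far Ox Oy.
have gap u v r s : (u.+3 <= v)%N -> r <= (endpoint n L u.+1)%:R * h ->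
    (endpoint n L v)%:R * h <= s -> (n %/ 2 ^ L).+1%:R * h <= s - r.
  move=> uv ru vs; have h0 : 0 <= h by rewrite invr_ge0.
  have : (endpoint n L u.+1 + (n %/ 2 ^ L).+1 <= endpoint n L v)%N.
    have := endpoint_leq n L uv; have := endpoint_step_ge n L u.+1 2.
    rewrite addn2; move: (n %/ 2 ^ L)%N q0 => q q0.
    move: (endpoint n L _) (endpoint n L _) (endpoint n L _) => e1 e2 e3; lia.
  rewrite -(ler_nat R) natrD => /(ler_wpM2r h0); rewrite mulrDl => gap; lra.
have /andP[xs xe] := Omega_box l Ox; have /andP[ys ye] := Omega_box l Oy.
move: far; rewrite /nearby negb_and -!ltnNge !addn2 => /orP[cb|bc].
  by rewrite (le_trans (gap _ _ _ _ cb ye xs))// ler_norm.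
by rewrite distrC (le_trans (gap _ _ _ _ bc xe ys))// ler_norm.
Qed.

Lemma far_strong_admissible L b c l : (0 < n %/ 2 ^ L)%N -> ~~ nearby (b l) (c l) ->
  points (box n L b) != finset.set0 -> points (box n L c) != finset.set0 ->
  @strong_admissible R d n (Num.sqrt d%:R) (box n L b) (box n L c).
Proof.
move=> q0 far b0 c0; rewrite /strong_admissible.
set r := (n %/ 2 ^ L).+1%:R * h.
have r0 : 0 <= r by rewrite mulr_ge0// invr_ge0.
apply: (@le_trans _ _ (Num.sqrt d%:R * r)).
  by rewrite ge_max !diam_le// => x y l' Ox Oy; exact: (Omega_box_width l' Ox Oy).
rewrite ler_wpM2l ?sqrtr_ge0//; apply: (dist_ge (l := l)); [exact: Omega_neq0..|].
by move=> x y Ox Oy; exact: Omega_box_gap Ox Oy.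
Qed.

Lemma far_weak_admissible L b c l : (0 < n)%N -> (0 < n %/ 2 ^ L)%N ->
  ~~ nearby (b l) (c l) -> @weak_admissible R d n (box n L b) (box n L c).
Proof.
move=> n0 q0 far; rewrite /weak_admissible.
have -> : (@Omega R d n (box n L b) `&` @Omega R d n (box n L c) = set0)%classic.
  rewrite -subset0 => x [Ox Oy].
  have := Omega_box_gap q0 far Ox Oy.
  by rewrite subrr normr0 leNgt mulr_gt0// invr_gt0 ltr0n.
exact: measure0.
Qed.

Lemma Omega_root_width x y l :
  @Omega R d n ([ffun=> finset.setT] : node) x ->
  @Omega R d n ([ffun=> finset.setT] : node) y ->
  `|Defs.coord x l - Defs.coord y l| <= n.+1%:R * h.
Proof.
rewrite root_box => Ox Oy.
by have := Omega_box_width l Ox Oy; rewrite expn0 divn1.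
Qed.

(** The distance of the domain to itself is 0, while its diameter is at least the
    side of one cell. *)
Lemma root_not_strong_admissible : (0 < d)%N -> (0 < n)%N ->
  ~ @strong_admissible R d n (Num.sqrt d%:R)
      ([ffun=> finset.setT] : node) [ffun=> finset.setT].
Proof.
move=> d0 n0; rewrite /strong_admissible maxxx => adm.
set O := @Omega R d n _ in adm.
have h0 : 0 < h by rewrite invr_gt0 ltr0n.
pose i : grid d n := [ffun=> Ordinal n0].
have iP : i \in points ([ffun=> finset.setT] : node).
  by rewrite inE; apply/forallP => l; rewrite !ffunE inE.
pose x : point := [tuple 0 | l < d]; pose y : point := [tuple h | l < d].
have Ox : O x.
  by exists i => // l; rewrite /Defs.coord !tnth_mktuple ffunE /= mul0r lexx mul1r ltW.
have Oy : O y.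
  by exists i => // l; rewrite /Defs.coord !tnth_mktuple ffunE /= mul0r mul1r lexx ltW.
have : h <= diam O.
  apply: (@le_trans _ _ (euclid x y)).
    have := euclid_ge x y (Ordinal d0).
    by rewrite /Defs.coord !tnth_mktuple sub0r normrN gtr0_norm.
  apply: ub_le_sup; last by exists x, y.
  exists (Num.sqrt d%:R * (n.+1%:R * h)) => _ [u [v [Ou Ov ->]]].
  apply: euclid_le => [|l]; first by rewrite mulr_ge0// ltW.
  exact: Omega_root_width.
have dist0 : dist O O <= 0.
  apply: ge_inf; last first.
    exists x, x; split=> //; rewrite /euclid big1 ?sqrtr0// => l _.
    by rewrite subrr expr0n.
  by exists 0 => _ [u [v [_ _ ->]]]; exact: sqrtr_ge0.
move=> hdiam; have := le_trans hdiam adm.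
by rewrite leNgt (le_lt_trans _ h0)// mulr_ge0_le0// sqrtr_ge0.
Qed.

End Geometry.

(** * Measure of the root *)

Section RootMeasure.
Context (R : realType).
Local Open Scope classical_set_scope.

Definition cuboid d (lo hi : 'I_d -> R) : set (d.-tuple (measurableTypeR R)) :=
  [set x | forall l, lo l <= Defs.coord x l <= hi l].

(** The measure in dimension d + 1 is defined through this preimage, and its
    product form allows induction on the dimension. *)
Lemma preimage_cuboid d (lo hi : 'I_d.+1 -> R) :
  @tuple_cons R d @^-1` cuboid lo hi =
  `[lo ord0, hi ord0] `*` cuboid (lo \o lift ord0) (hi \o lift ord0).
Proof.
apply/seteqP; split => -[x t] /=.
  move=> H; split; first by have := H ord0; rewrite /Defs.coord tnth0 in_itv.
  by move=> l; have := H (lift ord0 l); rewrite /Defs.coord tnthS.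
move=> [/= xlh H] l; case: (unliftP ord0 l) => [l'|] ->.
  by rewrite /Defs.coord tnthS; exact: H.
by rewrite /Defs.coord tnth0; move: xlh; rewrite in_itv.
Qed.

Lemma measurable_cuboid d (lo hi : 'I_d -> R) : measurable (cuboid lo hi).
Proof.
elim: d lo hi => [|d IHd] lo hi.
  rewrite (_ : cuboid _ _ = setT); first exact: measurableT.
  by apply/seteqP; split=> // x _ [].
rewrite (_ : cuboid lo hi = @tuple_uncons R d @^-1`
    (@tuple_cons R d @^-1` cuboid lo hi)); last first.
  have uK : cancel (@tuple_uncons R d) (@tuple_cons R d).
    by move=> x; rewrite [RHS]tuple_eta.
  by apply/seteqP; split=> x /=; rewrite /preimage /= uK.
rewrite -[X in measurable X]setTI; apply: measurable_tuple_uncons => //.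
by rewrite preimage_cuboid; apply: measurableX => //; exact: IHd.
Qed.

Lemma lebesgue_tuple_cuboid_gt0 d (lo hi : 'I_d -> R) :
  (forall l, lo l < hi l) -> (0 < lebesgue_tuple R d (cuboid lo hi))%E.
Proof.
elim: d lo hi => [|d IHd] lo hi lohi.
  rewrite (_ : cuboid _ _ = setT); first by rewrite /= diracT lte01.
  by apply/seteqP; split=> // x _ [].
rewrite [X in (_ < X)%E](_ : _ = (@lebesgue_measure R \x lebesgue_tuple R d)%E
  (@tuple_cons R d @^-1` cuboid lo hi))//.
rewrite preimage_cuboid product_measure1E//; last exact: measurable_cuboid.
rewrite mule_gt0 ?IHd// => [|l]; last exact: lohi.
by rewrite /= lebesgue_measure_itv/= lte_fin lohi lte_fin subr_gt0.
Qed.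

Lemma root_not_weak_admissible d n : (0 < n)%N ->
  ~ @weak_admissible R d n ([ffun=> finset.setT] : node d n) [ffun=> finset.setT].
Proof.
move=> n0; rewrite /weak_admissible setIid => O0.
pose i : grid d n := [ffun=> Ordinal n0].
have iP : i \in points ([ffun=> finset.setT] : node d n).
  by rewrite inE; apply/forallP => l; rewrite !ffunE inE.
have : (0 < lebesgue_tuple R d (@cell R d n i))%E.
  apply: lebesgue_tuple_cuboid_gt0 => l.
  by rewrite ltr_pM2r ?invr_gt0 ?ltr0n// ltr_nat.
rewrite (@subset_measure0 _ _ _ (lebesgue_tuple R d) (@cell R d n i) (@Omega R d n _) _ _ _ O0)
  ?ltxx//.
- exact: measurable_cuboid.
- rewrite (_ : @Omega R d n _ = \bigcup_(i in [set i : grid d n | i \in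
    points ([ffun=> finset.setT] : node d n)]) @cell R d n i); last by [].
  apply: fin_bigcup_measurable => [|j _]; last exact: measurable_cuboid.
  exact: finite_finset.
- by move=> x ix; exists i.
Qed.

End RootMeasure.

(** * Counting the pairs that are split *)

Section NearPairs.

(** Number of the pairs of intervals that lie j levels below the pair (b, c) and
    all of whose proper ancestors, from (b, c) on, are nearby.  A pair of boxes
    is split only if all its coordinates are nearby, so the product of these
    numbers over the coordinates bounds the number of its descendants. *)
Fixpoint near_pairs (j b c : nat) : nat :=
  if j is j'.+1 then
    if nearby b c then
      \sum_(e : bool) \sum_(e' : bool) near_pairs j' (2 * b + e) (2 * c + e')
    else 0
  else 1.

Lemma sum_bool2 (F : bool -> bool -> nat) :
  (\sum_(e : bool) \sum_(e' : bool) F e e' =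
   F true true + F true false + (F false true + F false false))%N.
Proof. by rewrite !big_bool. Qed.

Lemma near_pairsC j b c : near_pairs j b c = near_pairs j c b.
Proof.
elim: j b c => //= j IHj b c; rewrite /nearby andbC.
case: ifP => // _; rewrite exchange_big; apply: eq_bigr => e _.
by apply: eq_bigr => e' _.
Qed.

Lemma near_pairs_far j b c : ~~ nearby b c -> (near_pairs j b c <= 1)%N.
Proof. by case: j => //= j /negPf ->. Qed.

(** At distance 2 all four children are at distance at least 3. *)
Lemma near_pairs2 j b : (near_pairs j b (b + 2) <= 4)%N.
Proof.
case: j => //= j; case: ifP => // _; rewrite sum_bool2.
have far e e' : (near_pairs j (2 * b + nat_of_bool e)
    (2 * (b + 2) + nat_of_bool e') <= 1)%N.
  by apply: near_pairs_far; rewrite /nearby; case: e e' => -[] /=; lia.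
have := far true true; have := far true false.
have := far false true; have := far false false; lia.
Qed.

(** Adjacent intervals have one pair of adjacent children, two pairs at distance 2
    and one at distance 3, so the count grows by at most 4 + 4 + 1 per level. *)
Lemma near_pairs1 j b : (near_pairs j b b.+1 <= 9 * j + 1)%N.
Proof.
elim: j b => //= j IHj b; case: ifP => // _; rewrite sum_bool2 /=.
have h3 : (near_pairs j (2 * b + 0) (2 * b.+1 + 1) <= 1)%N.
  by apply: near_pairs_far; rewrite /nearby; lia.
have h2 := near_pairs2 j (2 * b + 1)%N; have h2' := near_pairs2 j (2 * b + 0)%N.
have h1 := IHj (2 * b + 1)%N.
have e1 : (2 * b + 1 + 2 = 2 * b.+1 + 1)%N by lia.
have e2 : (2 * b + 0 + 2 = 2 * b.+1 + 0)%N by lia.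
have e3 : ((2 * b + 1).+1 = 2 * b.+1 + 0)%N by lia.
move: h2 h2' h1; rewrite e1 e2 e3; lia.
Qed.

(** An interval with itself has two children of the same kind and two pairs of
    adjacent ones, whose count is only linear in j.  The terms 18 j + 20 make the
    doubling argument inductive. *)
Lemma near_pairs0 j b : (near_pairs j b b + 18 * j + 20 <= 21 * 2 ^ j)%N.
Proof.
elim: j b => //= j IHj b; rewrite /nearby leq_addr /= sum_bool2 /=.
have h1 := near_pairs1 j (2 * b)%N.
have e1 : ((2 * b).+1 = 2 * b + 1)%N by lia.
have h1' : (near_pairs j (2 * b + 1) (2 * b) <= 9 * j + 1)%N.
  by rewrite near_pairsC -e1.
have h0 := IHj (2 * b)%N; have h0' := IHj (2 * b + 1)%N.
rewrite e1 in h1; rewrite expnS addn0; lia.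
Qed.

(** The children of a pair of boxes are chosen independently in each coordinate,
    so the sum over them is a product. *)
Lemma near_pairs_children (d j : nat) (b c : 'I_d -> nat) :
  (forall l, nearby (b l) (c l)) ->
  (\sum_(e : {ffun 'I_d -> bool}) \sum_(e' : {ffun 'I_d -> bool})
     \prod_l near_pairs j (child_position b e l) (child_position c e' l) =
   \prod_l near_pairs j.+1 (b l) (c l))%N.
Proof.
move=> bc; under [RHS]eq_bigr => l _ do rewrite /= bc.
by rewrite bigA_distr_bigA; apply: eq_bigr => e _; rewrite bigA_distr_bigA.
Qed.

End NearPairs.

Lemma leq_geometric_sum m J : (0 < m)%N ->
  (\sum_(j < J.+1) (2 ^ j) ^ m <= 2 * (2 ^ J) ^ m)%N.
Proof.
move=> m0; elim: J => [|J IHJ]; first by rewrite big_ord1 expn0 exp1n.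
rewrite big_ord_recr /= (leq_trans (leq_add IHJ (leqnn _)))//.
have : (2 * (2 ^ J) ^ m <= (2 ^ J.+1) ^ m)%N.
  by rewrite [in leqRHS]expnS expnMn leq_mul2r -[X in (X <= _)%N]expn1 leq_pexp2l ?orbT.
lia.
Qed.

(** * Cost of the construction *)

Section Cost.
Context (R : realType) (d n n0 p : nat).
Local Notation point := (d.-tuple (measurableTypeR R)).
Context (a : point -> R) (k : point -> point -> R).
Local Notation node := (node d n).
Context (adm : node -> node -> Prop).
Context (d_ge2 : (2 <= d)%N) (n_gt0 : (0 < n)%N) (p_gt0 : (0 < p)%N)
  (p_le_n0 : (p <= n0)%N) (n0_le_2p : (n0 <= 2 * p)%N).
Context (far_admissible : forall L (b c : 'I_d -> nat) l,
  (0 < n %/ 2 ^ L)%N -> ~~ nearby (b l) (c l) ->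
  points (box n L b) != finset.set0 -> points (box n L c) != finset.set0 ->
  adm (box n L b) (box n L c)).

(** The factor 16^d comes from dense leaves: both nodes have sides of at most
    n0 + 1 <= 4p indices, so the block has at most (16 p^2)^d entries. *)
Definition leaf_const : nat := 52 * d * 16 ^ d.

Definition leaf_cost (L : nat) : nat :=
  leaf_const * (p ^ (2 * d + 1) + (n %/ 2 ^ L).+1 * p ^ 2).

Lemma ops_construct_node (tau sigma : node) ts :
  ops (construct a k p (BNode tau sigma ts)) =
  (\sum_(t <- ts) ops (construct a k p t))%N.
Proof.
by rewrite [construct _ _ _ _]/= ops_bind ops_ret addn0 ops_seqc big_map.
Qed.

Lemma leq_big_parts L (b : 'I_d -> nat) (F : node -> nat)
    (G : {ffun 'I_d -> bool} -> nat) : (forall l, b l < 2 ^ L)%N ->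
  (forall e, points (box n L.+1 (child_position b e)) != finset.set0 ->
     F (box n L.+1 (child_position b e)) <= G e)%N ->
  (\sum_(c <- Defs.parts (box n L b)) F c <= \sum_e G e)%N.
Proof.
move=> bL FG; rewrite parts_box// big_filter big_map big_enum_cond /= big_mkcond /=.
by apply: leq_sum => e _; case: ifP => // /FG.
Qed.

Lemma card_points_box_le L (b : 'I_d -> nat) : (forall l, b l < 2 ^ L)%N ->
  (#|points (box n L b)| <= (n %/ 2 ^ L).+1 ^ d)%N.
Proof.
move=> bL; rewrite card_points -[X in (_ ^ X)%N]card_ord -prod_nat_const.
by apply: leq_prod => l _; have /andP[] := card_box n (bL l).
Qed.

Lemma card_points_box_ge L (b : 'I_d -> nat) : (forall l, b l < 2 ^ L)%N ->
  ((n %/ 2 ^ L) ^ d <= #|points (box n L b)|)%N.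
Proof.
move=> bL; rewrite card_points -[X in (_ ^ X)%N]card_ord -prod_nat_const.
by apply: leq_prod => l _; have /andP[] := card_box n (bL l).
Qed.

Lemma ops_adm_leaf_box L (b c : 'I_d -> nat) :
  (forall l, b l < 2 ^ L)%N -> (forall l, c l < 2 ^ L)%N ->
  (ops (adm_leaf k p (box n L b) (box n L c)) <= leaf_cost L)%N.
Proof.
move=> bL cL.
have := @ops_adm_leaf_le R d n k p (box n L b) (box n L c) (n %/ 2 ^ L).+1.
move=> /(_ (ltnW d_ge2) p_gt0 isT) H; apply: leq_trans (H _ _) _.
- by move=> l; have /andP[] := card_box n (bL l).
- by move=> l; have /andP[] := card_box n (cL l).
by rewrite leq_mul2r /leaf_const leq_pmulr ?expn_gt0// orbT.
Qed.

(** A leaf of the cluster tree may be paired with a larger node of the same level,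
    but the sides of the two differ by at most one index. *)
Lemma ops_dense_leaf_box L (b c : 'I_d -> nat) : (n %/ 2 ^ L <= n0)%N ->
  (forall l, b l < 2 ^ L)%N -> (forall l, c l < 2 ^ L)%N ->
  (ops (dense_leaf a k (box n L b) (box n L c)) <= leaf_cost L)%N.
Proof.
move=> qn0 bL cL; apply: leq_trans (ops_dense_leaf_le _ _ _ _) _.
rewrite -!card_points.
have hq : ((n %/ 2 ^ L).+1 ^ d <= (4 * p) ^ d)%N.
  by rewrite leq_exp2r ?(ltnW d_ge2)//; lia.
have hb := leq_trans (card_points_box_le bL) hq.
have hc := leq_trans (card_points_box_le cL) hq.
apply: (@leq_trans ((4 * p) ^ d * (4 * p) ^ d * (10 * d))).
  by rewrite !leq_mul//; lia.
rewrite /leaf_cost mulnDr; apply: leq_trans (leq_addr _ _).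
rewrite -expnMn (_ : 4 * p * (4 * p) = 16 * p ^ 2)%N; last by lia.
rewrite expnMn -expnM /leaf_const.
have : (p ^ (2 * d) <= p ^ (2 * d + 1))%N by rewrite leq_pexp2l// leq_addr.
move: (16 ^ d)%N (p ^ (2 * d + 1))%N (p ^ (2 * d))%N => X Y Z YZ.
rewrite (leq_trans (leq_mul (leq_mul (leqnn X) YZ) (leqnn (10 * d)%N)))//.
rewrite (_ : X * Y * (10 * d) = 10 * (d * X * Y))%N; last by lia.
by rewrite (_ : 52 * d * X * Y = 52 * (d * X * Y))%N ?leq_mul2r ?orbT//; lia.
Qed.

(** A box with more than n0^d points has a side of more than n0 indices, and no
    side has more than q + 1. *)
Lemma big_box_ge L (b : 'I_d -> nat) : (forall l, b l < 2 ^ L)%N ->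
  (n0 ^ d < #|points (box n L b)|)%N -> (n0 <= n %/ 2 ^ L)%N.
Proof.
move=> bL /leq_trans/(_ (card_points_box_le bL)).
by rewrite ltn_exp2r ?ltnS// ltnW.
Qed.

Lemma small_box_le L (b : 'I_d -> nat) : (forall l, b l < 2 ^ L)%N ->
  (#|points (box n L b)| <= n0 ^ d)%N -> (n %/ 2 ^ L <= n0)%N.
Proof.
move=> bL /(leq_trans (card_points_box_ge bL)).
by rewrite leq_exp2r// ltnW.
Qed.

(** J bounds the number of remaining levels: at level L + J every box has sides
    of at most n0 indices and is a leaf.  The cost is charged to the level at
    which it occurs; a pair that is split is nearby in each coordinate, so
    [near_pairs_children] turns the sum over its children into the terms of one
    level further down. *)
Lemma ops_partition_block_le J f L (b c : 'I_d -> nat) :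
  (J <= f)%N -> (n < n0 * 2 ^ (L + J))%N ->
  (forall l, b l < 2 ^ L)%N -> (forall l, c l < 2 ^ L)%N ->
  points (box n L b) != finset.set0 -> points (box n L c) != finset.set0 ->
  (ops (construct a k p
      (partition_block adm (n0 ^ d) f (box n L b) (box n L c))) <=
   \sum_(j < J.+1) leaf_cost (L + j) * \prod_l near_pairs j (b l) (c l))%N.
Proof.
elim: J f L b c => [|J IHJ] f L b c Jf nL bL cL b0 c0;
  rewrite big_ord_recl [X in (_ * X)%N]big1 // addn0 muln1;
  case: partition_blockP => // [_|_ small|f' nadm ff' big_b _].
- by rewrite construct_adm (leq_trans (ops_adm_leaf_box bL cL))// leq_addr.
- rewrite (leq_trans _ (leq_addr _ _))//; apply: ops_dense_leaf_box => //.
  by rewrite ltnW// ltn_divLR ?expn_gt0// -[L]addn0.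
- have := big_box_ge bL big_b.
  by rewrite leqNgt ltn_divLR ?expn_gt0// -[X in (2 ^ X)%N]addn0 nL.
- by rewrite construct_adm (leq_trans (ops_adm_leaf_box bL cL))// leq_addr.
- rewrite (leq_trans _ (leq_addr _ _))//; apply: ops_dense_leaf_box => //.
  case: small; [move=> f0|exact: small_box_le..].
  by move: Jf; rewrite f0.
have q_gt0 := leq_trans (leq_trans p_gt0 p_le_n0) (big_box_ge bL big_b).
have bc l : nearby (b l) (c l).
  by apply/negPn/negP => far; apply: nadm; exact: far_admissible far b0 c0.
rewrite (leq_trans _ (leq_addl _ _))// ops_construct_node big_allpairs_dep.
rewrite (@leq_trans (\sum_(e : {ffun 'I_d -> bool}) \sum_(e' : {ffun 'I_d -> bool})
  \sum_(j < J.+1) leaf_cost (L.+1 + j) *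
    \prod_l near_pairs j (child_position b e l) (child_position c e' l)))//.
  apply: leq_big_parts => // e e0; apply: leq_big_parts => // e' e'0.
  apply: IHJ => //; [lia|by rewrite addSnnS| |]; exact: child_position_lt.
under eq_bigr do rewrite exchange_big.
rewrite exchange_big /=; apply: leq_sum => j _.
rewrite /bump /= add1n -(near_pairs_children j bc) big_distrr addSnnS /=.
by apply: leq_sum => e _; rewrite big_distrr.
Qed.

(** Both sums over the levels are geometric with ratio at least 2, namely 2^d and
    2^(d-1); the latter is why the dimension must be at least 2.  The factors
    8 2^d are 2 2^d for the cores and 3 2 2^d for the factor matrices. *)
Lemma leaf_cost_sum_le J : (n0 * 2 ^ J <= 2 * n)%N ->
  (\sum_(j < J.+1) leaf_cost (0 + j) * \prod_(l < d) near_pairs j 0 0 <=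
   leaf_const * 21 ^ d * (8 * 2 ^ d) * (p ^ (d + 1) * n ^ d))%N.
Proof.
move=> Jn; have J2n : (2 ^ J <= 2 * n)%N by move: (2 ^ J)%N Jn => X Jn; nia.
have term j : (j < J.+1)%N -> (leaf_cost (0 + j) * \prod_(l < d) near_pairs j 0 0 <=
    leaf_const * 21 ^ d * (p ^ (2 * d + 1) * (2 ^ j) ^ d +
      3 * n * p ^ 2 * (2 ^ j) ^ d.-1))%N.
  rewrite ltnS => jJ; rewrite add0n prod_nat_const card_ord.
  have h1 : (near_pairs j 0 0 ^ d <= 21 ^ d * (2 ^ j) ^ d)%N.
    rewrite -expnMn leq_exp2r ?(ltnW d_ge2)//.
    by have := near_pairs0 j 0; move: (2 ^ j)%N => X; lia.
  apply: leq_trans (leq_mul (leqnn _) h1) _; rewrite /leaf_cost.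
  rewrite -[leqLHS]mulnA -[leqRHS]mulnA leq_mul2l; apply/orP; right.
  rewrite [leqLHS]mulnCA leq_mul2l; apply/orP; right.
  rewrite mulnDl leq_add2l.
  have -> : ((2 ^ j) ^ d = 2 ^ j * (2 ^ j) ^ d.-1)%N.
    by rewrite -expnS prednK// ltnW.
  have q2 : ((n %/ 2 ^ j).+1 * 2 ^ j <= 3 * n)%N.
    rewrite mulSn; have := leq_trunc_div n (2 ^ j).
    have : (2 ^ j <= 2 ^ J)%N by rewrite leq_pexp2l.
    by move: (2 ^ j)%N (2 ^ J)%N J2n (n %/ _ * _)%N => X Y; lia.
  by rewrite mulnACA -[leqRHS]mulnA leq_mul.
apply: (@leq_trans (\sum_(j < J.+1) leaf_const * 21 ^ d *
    (p ^ (2 * d + 1) * (2 ^ j) ^ d + 3 * n * p ^ 2 * (2 ^ j) ^ d.-1))).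
  by apply: leq_sum => j _; exact: term.
rewrite -big_distrr /= -[leqRHS]mulnA leq_mul2l; apply/orP; right.
rewrite big_split /= -!big_distrr /=.
have d1 : (0 < d.-1)%N by lia.
have g1 := leq_geometric_sum J (ltnW d_ge2); have g2 := leq_geometric_sum J d1.
have h1 : (p ^ (2 * d + 1) * (2 ^ J) ^ d <= 2 ^ d * (p ^ (d + 1) * n ^ d))%N.
  rewrite (_ : 2 * d + 1 = d + 1 + d)%N; last by lia.
  rewrite expnD -mulnA -expnMn [leqRHS]mulnCA leq_mul2l -expnMn leq_exp2r ?(ltnW d_ge2)//.
  by rewrite (leq_trans _ Jn) ?orbT// leq_mul2r p_le_n0 orbT.
have h2 : (n * p ^ 2 * (2 ^ J) ^ d.-1 <= 2 ^ d * (p ^ (d + 1) * n ^ d))%N.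
  have e1 : (p ^ 2 <= p ^ (d + 1))%N by rewrite leq_pexp2l//; lia.
  have e2 : ((2 ^ J) ^ d.-1 <= (2 * n) ^ d.-1)%N by rewrite leq_exp2r.
  have e3 : (n ^ d = n * n ^ d.-1)%N by rewrite -expnS prednK// ltnW.
  have e4 : (2 ^ d.-1 <= 2 ^ d)%N by rewrite leq_pexp2l// leq_pred.
  rewrite (mulnC n) -mulnA e3.
  rewrite [leqRHS](_ : _ = p ^ (d + 1) * (n * (2 ^ d * n ^ d.-1)))%N; last by lia.
  rewrite leq_mul// leq_mul2l (leq_trans e2) ?orbT// expnMn leq_mul2r e4 orbT//.
apply: leq_trans (leq_add (leq_mul (leqnn _) g1) (leq_mul (leqnn _) g2)) _.
have -> : (8 * 2 ^ d * (p ^ (d + 1) * n ^ d) =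
    8 * (2 ^ d * (p ^ (d + 1) * n ^ d)))%N by rewrite -[LHS]mulnA.
move: (2 ^ d * _)%N h1 h2 => W h1 h2.
rewrite (mulnCA _ 2) (mulnCA _ 2) -(mulnA 3) -(mulnA 3).
move: (p ^ _ * _)%N (n * _ * _)%N h1 h2 => U V; lia.
Qed.

Definition total_const : nat := leaf_const * 21 ^ d * (8 * 2 ^ d).

(** The last level J.+1 is the least one with n < n0 2^(J+1), so that
    n0 2^J <= n.  As 2^J <= n, the fuel n^d suffices for all levels. *)
Lemma ops_construct_le_big : (n0 < n)%N ->
  (ops (construct a k p (block_cluster_tree adm (n0 ^ d))) <=
     total_const * (p ^ (d + 1) * n ^ d))%N.
Proof.
move=> n0n; have n0_gt0 := leq_trans p_gt0 p_le_n0.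
have exJ : exists J, (n < n0 * 2 ^ J)%N.
  by exists n; rewrite (leq_trans (ltn_expl n (ltnSn 1)))// leq_pmull.
case: (ex_minnP exJ) => -[|J] nJ minJ; first by rewrite muln1 ltnNge ltnW in nJ.
have Jn : (n0 * 2 ^ J <= n)%N.
  by rewrite leqNgt; apply/negP => /minJ; rewrite ltnn.
have fuel : (J.+1 <= #|{: grid d n}|)%N.
  rewrite card_ffun !card_ord (@leq_trans n)//.
    rewrite (leq_trans (ltn_expl J (ltnSn 1)))// (leq_trans _ Jn)//.
    by rewrite leq_pmull.
  by rewrite -[X in (X <= _)%N]expn1 leq_pexp2l// ltnW.
have root0 := points_root d n_gt0; rewrite root_box in root0.
rewrite /block_cluster_tree /cluster_tree root_box.
apply: leq_trans (ops_partition_block_le fuel _ _ _ root0 root0) _ => //.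
by apply: leaf_cost_sum_le; rewrite expnS mulnCA leq_mul2l.
Qed.

(** The root is a single dense block, with at most n^d n0^d entries. *)
Lemma ops_construct_le_small : (n <= n0)%N ->
  ~ adm [ffun=> finset.setT] [ffun=> finset.setT] ->
  (ops (construct a k p (block_cluster_tree adm (n0 ^ d))) <=
     total_const * (p ^ (d + 1) * n ^ d))%N.
Proof.
move=> nn0 nadm; have root0 := points_root d n_gt0.
have root_small : (#|points ([ffun=> finset.setT] : node)| <= n ^ d)%N.
  by rewrite -[X in (_ <= _ ^ X)%N]card_ord -[X in (_ <= X ^ _)%N](card_ord n)
    -card_ffun max_card.
have root_le : (#|points ([ffun=> finset.setT] : node)| <= n0 ^ d)%N.
  by rewrite (leq_trans root_small)// leq_exp2r// ltnW.
rewrite -[block_cluster_tree _ _]/(partition_block adm (n0 ^ d) _ _ _).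
case: partition_blockP => // [_ _|f' _ _]; last by rewrite ltnNge root_le.
apply: leq_trans (ops_dense_leaf_le a k _ _) _; rewrite -!card_points.
have h1 : (n0 ^ d <= 2 ^ d * p ^ (d + 1))%N.
  rewrite (@leq_trans ((2 * p) ^ d))// ?leq_exp2r//; first by rewrite ltnW.
  by rewrite expnMn leq_mul2l leq_pexp2l ?leq_addr ?orbT.
have h2 : (5 * d + 5 <= 52 * d)%N by lia.
apply: leq_trans (leq_mul (leq_mul (leq_trans root_le h1) root_small) h2) _.
rewrite /total_const /leaf_const.
have h3 : (1 <= 16 ^ d * 21 ^ d * 8)%N by rewrite !muln_gt0 !expn_gt0.
move: (16 ^ d)%N (21 ^ d)%N (2 ^ d)%N (p ^ _)%N (n ^ d)%N h3 => X Y Z P N h3.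
have -> : (52 * d * X * Y * (8 * Z) * (P * N) =
  Z * P * N * (52 * d) * (X * Y * 8))%N by lia.
exact: leq_pmulr.
Qed.

End Cost.

Theorem mainTheorem5 (d : nat) (d_ge2 : (2 <= d)%N) :
  exists C : nat, forall (R : realType) (n n0 p : nat)
    (a : d.-tuple (measurableTypeR R) -> R)
    (k : d.-tuple (measurableTypeR R) -> d.-tuple (measurableTypeR R) -> R)
    (adm : node d n -> node d n -> Prop),
  (0 < n)%N -> (0 < n0)%N -> (0 < p)%N -> (p <= n0 <= 2 * p)%N ->
  adm = @weak_admissible R d n \/
    adm = @strong_admissible R d n (Num.sqrt d%:R) ->
  let T := block_cluster_tree adm (n0 ^ d) in
  let run := construct a k p T in
  (exists M : grid d n -> grid d n -> R,
     HTLR_matrix p T (result run) M /\ interpolates a k p T M) /\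
  (ops run <= C * p ^ (d + 1) * n ^ d)%N.
Proof.
exists (total_const d) => R n n0 p a k adm n_gt0 _ p_gt0 /andP[pn0 n02p] admE T run.
split; first exact: construct_correct.
rewrite -mulnA; have [nn0|n0n] := leqP n n0.
  apply: ops_construct_le_small => //.
  case: admE => ->; first exact: root_not_weak_admissible.
  by apply: root_not_strong_admissible; first exact: ltnW.
apply: ops_construct_le_big => // L b c l q_gt0 far b0 c0.
case: admE => ->; first exact: far_weak_admissible far.
exact: far_strong_admissible far b0 c0.
Qed.
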